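(* Let $p\ge 2$, let $F$ be a distribution on $\mathbb{R}^p$, let $X\sim F$, let $X_1,X_2,\ldots$ be independent random vectors with distribution $F$, let $\mathbb{X}_n=(X_1,\ldots,X_n)^T$, let $t\in\mathbb{R}^p$, and let $(t_n)_{n\in\mathbb{N}}$ be a sequence of random $p$-vectors (defined on the same probability space as the $X_i$). Suppose that (I) $E|t_n-t|^4=O(n^{-2})$ as $n\to\infty$, (II) $E|X-t|^{-3/2}<\infty$, and (III) $\sqrt{n}\begin{pmatrix} t_n-t\\ \mathrm{vec}\{S_n(\mathbb{X}_n,t)-S(F,t)\}\end{pmatrix}\to N_{p+p^2}(0,\Xi)$ in distribution, for some symmetric $p(p+1)\times p(p+1)$ matrix $\Xi$. Then $\sqrt{n}\,\mathrm{vec}\{S_n(\mathbb{X}_n,t_n)-S(F,t)\}\to N_{p^2}(0,A\Xi A^T)$ in distribution, where $A=(B,\,I_{p^2})\in\mathbb{R}^{p^2\times p(p+1)}$, $I_{p^2}$ is the $p^2\times p^2$ identity matrix, and $B\in\mathbb{R}^{p^2\times p}$ is given by $$B=2E\left[\frac{\{(X-t)\otimes(X-t)\}(X-t)^T}{|X-t|^4}\right]-E\left\{\frac{X-t}{|X-t|^2}\right\}\otimes I_p-I_p\otimes E\left\{\frac{X-t}{|X-t|^2}\right\}.$$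
   Context: $|\cdot|$ denotes the Euclidean norm on $\mathbb{R}^p$; $\otimes$ denotes the Kronecker product. The spatial sign of $x\in\mathbb{R}^p$ is $s(x)=x/|x|$ for $x\neq 0$ and $s(0)=0$. For $X\sim F$ and $t\in\mathbb{R}^p$, $S(F,t)=E\{s(X-t)s(X-t)^T\}$. For a (possibly random) $u\in\mathbb{R}^p$, $S_n(\mathbb{X}_n,u)=\frac1n\sum_{i=1}^n s(X_i-u)s(X_i-u)^T$. For a matrix $M\in\mathbb{R}^{m\times n}$, $\mathrm{vec}\,M$ is the $mn$-vector obtained by stacking the columns of $M$ from left to right underneath each other. $N_k(0,\Sigma)$ denotes the $k$-variate normal distribution with mean $0$ and covariance $\Sigma$. *)

(* Defs.v *)
From HB Require Import structures.
From mathcomp Require Import all_boot all_order all_algebra.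
From mathcomp Require Import all_classical all_reals all_analysis.
Set Implicit Arguments. Unset Strict Implicit. Unset Printing Implicit Defensive.
Import Order.TTheory GRing.Theory Num.Theory.
Import numFieldNormedType.Exports.
Local Open Scope classical_set_scope.
Local Open Scope ring_scope.

Section Defs.
Variable R : realType.

Definition enorm (p : nat) (v : 'cV[R]_p) : R := Num.sqrt (\sum_(k < p) v k 0 ^+ 2).

Definition ssign (p : nat) (v : 'cV[R]_p) : 'cV[R]_p :=
  if v == 0 then 0 else (enorm v)^-1 *: v.

(** index splitting 'I_(m*n) ~ 'I_m * 'I_n in lexicographic order
    (first component major), i.e. k = i * n + j. *)
Definition ix (m n : nat) (k : 'I_(m * n)) : 'I_m * 'I_n :=
  enum_val (cast_ord (esym (mxvec_cast m n)) k).

(** vec: stack the columns of A (left to right) underneath each other;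
    entry number j*m + i of vec A is A i j. *)
Definition vec (m n : nat) (A : 'M[R]_(m, n)) : 'cV[R]_(n * m) :=
  \col_k A (ix k).2 (ix k).1.

Definition kron (m1 n1 m2 n2 : nat) (A : 'M[R]_(m1, n1)) (B : 'M[R]_(m2, n2))
  : 'M[R]_(m1 * m2, n1 * n2) :=
  \matrix_(r, c) (A (ix r).1 (ix c).1 * B (ix r).2 (ix c).2).

(** Borel sigma-algebra of R^p (generated by the coordinate maps) *)
Definition vmeas (p : nat) : set (set 'cV[R]_p) :=
  <<s [set A | exists (k : 'I_p) (B : set R), measurable B /\
                 A = (fun v : 'cV[R]_p => v k 0) @^-1` B] >>.

Section Prob.
Context {d : measure_display} {T : measurableType d} (P : probability T R).

Definition rvec (p : nat) (V : T -> 'cV[R]_p) : Prop :=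
  forall k : 'I_p, measurable_fun setT (fun w => V w k 0).

Definition same_law (p : nat) (V W : T -> 'cV[R]_p) : Prop :=
  forall A, vmeas A -> P (V @^-1` A) = P (W @^-1` A).

Definition mutually_indep (p : nat) (V : nat -> T -> 'cV[R]_p) : Prop :=
  forall (s : seq nat) (B : nat -> set 'cV[R]_p), uniq s ->
    (forall i, i \in s -> vmeas (B i)) ->
    P (\bigcap_(i in [set` s]) (V i @^-1` B i)) =
    (\prod_(i <- s) P (V i @^-1` B i))%E.

Definition mexp (m n : nat) (M : T -> 'M[R]_(m, n)) : 'M[R]_(m, n) :=
  \matrix_(i, j) Rintegral P setT (fun w => M w i j).

End Prob.

(** E g(Z) for Z ~ N_k(0, I_k), as an iterated integral against the
    standard normal density (first coordinate outermost). *)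
Fixpoint gauss_exp (k : nat) : ('cV[R]_k -> R) -> R :=
  match k with
  | 0%N => fun g => g 0
  | j.+1 => fun g => Rintegral (@lebesgue_measure R) setT
      (fun x => normal_pdf 0 1 x *
                gauss_exp (fun v : 'cV[R]_j => g (col_mx (@scalar_mx R 1 x) v)))
  end.

(** Convergence in distribution of the random k-vectors Y n to N_k(0, Sig):
    N_k(0,Sig) is the law of L Z with Z ~ N_k(0, I_k) and L L^T = Sig;
    convergence in distribution = convergence of E g(Y n) for every bounded
    continuous g : R^k -> R. *)
Definition cvg_dist_normal {d : measure_display} {T : measurableType d}
  (P : probability T R) (k : nat) (Y : nat -> T -> 'cV[R]_k) (Sig : 'M[R]_k) : Prop :=
  exists L : 'M[R]_k, L *m L^T = Sig /\
    forall g : 'cV[R]_k -> R, continuous g -> (exists M : R, forall v, `|g v| <= M) ->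
      (fun n => Rintegral P setT (fun w => g (Y n w))) @ \oo -->
        gauss_exp (fun z => g (L *m z)).

Section Paper.
Context {d : measure_display} {T : measurableType d} (P : probability T R).
Variable p : nat.

Definition SF (X : T -> 'cV[R]_p) (t : 'cV[R]_p) : 'M[R]_p :=
  mexp P (fun w => ssign (X w - t) *m (ssign (X w - t))^T).

(** S_n(X_n, u) = 1/n sum_{i=1}^n s(X_i-u) s(X_i-u)^T, X_i := Xs (i-1), at outcome w *)
Definition Sn (Xs : nat -> T -> 'cV[R]_p) (n : nat) (u : 'cV[R]_p) (w : T) : 'M[R]_p :=
  (n%:R)^-1 *: \sum_(i < n) (ssign (Xs i w - u) *m (ssign (Xs i w - u))^T).

Definition inv_pow32 (v : 'cV[R]_p) : \bar R :=
  if v == 0 then +oo%E else ((enorm v) `^ (- (3 / 2)))%:E.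

Definition Bmat (X : T -> 'cV[R]_p) (t : 'cV[R]_p) : 'M[R]_(p * p, p) :=
  2%:R *: mexp P (fun w => (enorm (X w - t) ^+ 4)^-1 *:
                       (kron (X w - t) (X w - t) *m (X w - t)^T))
  - castmx (erefl (p * p)%N, mul1n p)
      (kron (mexp P (fun w => (enorm (X w - t) ^+ 2)^-1 *: (X w - t))) (1%:M : 'M[R]_p))
  - castmx (erefl (p * p)%N, muln1 p)
      (kron (1%:M : 'M[R]_p) (mexp P (fun w => (enorm (X w - t) ^+ 2)^-1 *: (X w - t)))).

Definition Amat (X : T -> 'cV[R]_p) (t : 'cV[R]_p) : 'M[R]_(p * p, p + p * p) :=
  row_mx (Bmat X t) 1%:M.

End Paper.
End Defs.

(* Main.v *)
(** Let [f x = s(x) s(x)^T], with derivative [D f] away from [0], and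
    [h = t_n - t].  Since [f (x - h) - f x + D f x h] is [O(|h|/|x|)] for
    [|h| >= |x|/2] and [O(|h|^2/|x|^2)] for [|h| < |x|/2], it is
    [O((|h|/|x|)^(3/2))] for every [x <> 0].  Summing over [x = X_i - t], the remainder of
    [sqrt n (S_n(t_n) - S_n(t))] is at most
    [sqrt n |h|^(3/2) * (1/n) sum_i |X_i - t|^(-3/2)]: by (I) the first factor
    tends to [0] in mean, by (II) the second one is bounded in mean.  The linear
    part is [(1/n) sum_i (- D f (X_i - t))] applied to [sqrt n h]; the weak law of
    large numbers replaces the average by [B].  Hence the scaled covariance is
    [A Z_n + o_P(1)], [Z_n] being the vector in (III), and Slutsky's lemma, proved
    with Lipschitz inf-convolutions of the test function, gives the limit law of
    [A L z], [L L^T = Xi].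

    The limit has to be exhibited as the law of [N z] with [N] square.  The
    standard Gaussian is invariant under plane rotations (products of shears,
    which preserve Lebesgue measure), so Givens rotations can move a kernel vector
    of the wide matrix [A L] onto the first axis, and the corresponding zero
    column is integrated out; repeating this leaves a square [N] with
    [N N^T = A Xi A^T]. *)
Require Import Defs.
From HB Require Import structures.
From mathcomp Require Import all_boot all_order all_algebra.
From mathcomp Require Import all_classical all_reals all_analysis.
From mathcomp Require Import measurable_realfun ring lra.
Import Order.TTheory GRing.Theory Num.Theory.
Import numFieldNormedType.Exports.
Set Implicit Arguments. Unset Strict Implicit. Unset Printing Implicit Defensive.
Local Open Scope classical_set_scope.
Local Open Scope ring_scope.

(** * Sequential continuity and measurability *)

(** [tn n] may depend on the sample in any way, so the product of a power of |h| with a sample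
    average cannot be integrated by independence: (I) and (II) control each factor only separately.
    The remainders are therefore handled in probability, measured by E min(1, |U|), and a product is
    first split into a weighted sum. The exponent 3/2 balances two demands: above 1 it makes sqrt n
    |h|^(3/2) of order n^(-1/4), while the full second order |h|^2 would call for an inverse moment
    of order 2. On the Gaussian side, [gauss_exp] is an iterated real integral, so each step needs
    the inner integral to be a measurable function of the outer variable. Bounded sequentially
    continuous functions form a class stable under fixing coordinates, composition with a matrix and
    integration over the remaining coordinates; this is why they are the test functions throughout.
    Explicit rotations take the place of characteristic functions in changing the factor of a
    covariance matrix. *)

Section SequentialContinuity.
Variable R : realType.
Implicit Types k m : nat.

(* Coordinatewise convergence; [seqcont] is what survives integration over some
   of the coordinates, by dominated convergence. *)
Definition ccvg k (u : nat -> 'cV[R]_k) (v : 'cV[R]_k) : Prop :=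
  forall i, u n i 0 @[n --> \oo] --> v i 0.

Definition seqcont k (g : 'cV[R]_k -> R) : Prop :=
  forall u v, ccvg u v -> g (u n) @[n --> \oo] --> g v.

Lemma continuous_seqcont k (g : 'cV[R]_k -> R) : continuous g -> seqcont g.
Proof.
move=> cg u v uv; apply: (cvg_comp u g _ (cg v)) => A [B nB sB].
have H : \forall n \near \oo, forall i, B i 0 (u n i 0).
  by apply: filter_forall => i; exact: (uv i _ (nB i 0)).
by apply: filterS H => n Hn; apply: sB => i j; rewrite (ord1 j).
Qed.

Lemma ccvg_cst k (v : 'cV[R]_k) : ccvg (fun=> v) v.
Proof. by move=> i; exact: cvg_cst. Qed.

Lemma ccvg_mulmx m k (A : 'M[R]_(m, k)) u v :
  ccvg u v -> ccvg (fun n => A *m u n) (A *m v).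
Proof.
move=> uv i; rewrite mxE.
under eq_fun do rewrite mxE.
apply: cvg_big => [|j _]; first exact: add_continuous.
by apply: cvgMl_tmp; exact: uv.
Qed.

Lemma ccvg_col_mx m k (u : nat -> 'cV[R]_m) (u' : nat -> 'cV[R]_k) v v' :
  ccvg u v -> ccvg u' v' -> ccvg (fun n => col_mx (u n) (u' n)) (col_mx v v').
Proof.
move=> uv uv' i; case: (splitP i) => j ij.
- have -> : i = lshift k j by apply/val_inj.
  by rewrite col_mxEu; under eq_fun do rewrite col_mxEu; exact: uv.
- have -> : i = rshift m j by apply/val_inj.
  by rewrite col_mxEd; under eq_fun do rewrite col_mxEd; exact: uv'.
Qed.

Lemma ccvg_scalar (x : nat -> R) l : x n @[n --> \oo] --> l ->
  ccvg (fun n => (x n)%:M : 'cV[R]_1) l%:M.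
Proof.
by move=> xl i; rewrite (ord1 i) mxE; under eq_fun do rewrite mxE.
Qed.

Lemma seqcont_mulmx m k (A : 'M[R]_(m, k)) g :
  seqcont g -> seqcont (fun v => g (A *m v)).
Proof. by move=> sg u v uv; apply: sg; exact: ccvg_mulmx. Qed.

Lemma seqcont_continuous (f : R -> R) :
  (forall x l, x n @[n --> \oo] --> l -> f (x n) @[n --> \oo] --> f l) ->
  continuous f.
Proof. by move=> H x; apply/(@cvg_nbhsP _ R^o) => u; exact: H. Qed.

(** Every preimage under [f \o Z] is a countable union of fibres of [Z]. It serves for integer
    vectors [Z], where [f] is an arbitrary function of the rounded coordinates. *)
Lemma measurable_fun_countable_comp d (T : measurableType d) d'
    (U : measurableType d') (I : countType) (Z : T -> I) (f : I -> U) :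
  (forall z, measurable (Z @^-1` [set z])) ->
  measurable_fun setT (f \o Z).
Proof.
move=> mZ _ B mB; rewrite setTI.
have -> : (f \o Z) @^-1` B = \bigcup_(z in [set z | B (f z)]) Z @^-1` [set z].
  apply/seteqP; split => [w Bw|w [z Bz Zw]]; first by exists (Z w).
  by rewrite /= Zw.
rewrite bigcup_mkcond; apply: countable_bigcupT_measurable.
  exact: countableP.
by move=> z; case: ifP.
Qed.

Lemma measurable_floor_eq d (T : measurableType d) (f : T -> R) (z : int) :
  measurable_fun setT f -> measurable [set w | Num.floor (f w) = z].
Proof.
move=> mf; have -> : [set w | Num.floor (f w) = z] =
    f @^-1` `[z%:~R, (z + 1)%:~R[%classic.
  apply/seteqP; split => w /=; rewrite in_itv /=.
    by move=> <-; exact: floor_itv.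
  by move=> H; exact: floor_def.
by rewrite -[X in measurable X]setTI; apply: mf => //; exact: measurable_itv.
Qed.

Lemma cvg_floor_scaled (x : R) :
  (Num.floor (n.+1%:R * x))%:~R / n.+1%:R @[n --> \oo] --> x.
Proof.
apply: (@squeeze_cvgr _ _ _ _ (fun n => x - n.+1%:R^-1) (cst x)).
- apply: nearW => n; have n0 : (0 : R) < n.+1%:R by [].
  have /andP[h1 h2] := floor_itv (n.+1%:R * x).
  rewrite ler_pdivlMr// ler_pdivrMr// [x * _]mulrC h1 andbT.
  rewrite mulrBl mulVf ?gt_eqF// [x * _]mulrC lerBlDr.
  by rewrite intrD in h2; exact: ltW.
- rewrite -[X in _ --> X]subr0; apply: cvgB; first exact: cvg_cst.
  exact: cvg_harmonic.
- exact: cvg_cst.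
Qed.

(* [V] is approximated by the countably-valued maps [floor (n V) / n]. *)
Lemma measurable_seqcont_comp d (T : measurableType d) k (V : T -> 'cV[R]_k)
    (g : 'cV[R]_k -> R) :
  (forall i, measurable_fun setT (fun w => V w i 0)) -> seqcont g ->
  measurable_fun setT (fun w => g (V w)).
Proof.
move=> mV sg.
pose Z n w : 'cV[int]_k := \col_i Num.floor (n.+1%:R * V w i 0).
pose f n (z : 'cV[int]_k) : R := g (\col_i ((z i 0)%:~R / n.+1%:R)).
apply: (@measurable_fun_cvg _ _ _ _ (fun n => f n \o Z n)) => [n|w _].
- apply: measurable_fun_countable_comp => z.
  have -> : Z n @^-1` [set z] =
      \bigcap_(i in [set` enum 'I_k]) [set w | Num.floor (n.+1%:R * V w i 0) = z i 0].
    apply/seteqP; split => w /=.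
      by move=> <- i _ /=; rewrite mxE.
    move=> H; apply/matrixP => i j; rewrite (ord1 j) mxE.
    by apply: H => /=; rewrite mem_enum.
  apply: fin_bigcap_measurable => // i _; apply: measurable_floor_eq.
  by apply: measurable_funM => //; exact: mV.
- apply: sg => i; rewrite /Z; under eq_fun do rewrite !mxE.
  exact: cvg_floor_scaled.
Qed.

Definition norm1 k (v : 'cV[R]_k) : R := \sum_i `|v i 0|.

Lemma norm1_ge0 k (v : 'cV[R]_k) : 0 <= norm1 v.
Proof. exact: sumr_ge0. Qed.

Lemma norm1D k (u v : 'cV[R]_k) : norm1 (u + v) <= norm1 u + norm1 v.
Proof.
by rewrite -big_split /=; apply: ler_sum => i _; rewrite mxE; exact: ler_normD.
Qed.

Lemma norm1N k (v : 'cV[R]_k) : norm1 (- v) = norm1 v.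
Proof. by apply: eq_bigr => i _; rewrite mxE normrN. Qed.

Lemma norm10 k : norm1 (0 : 'cV[R]_k) = 0.
Proof. by rewrite /norm1 big1// => i _; rewrite mxE normr0. Qed.

Lemma norm1_mulmx m k (A : 'M[R]_(m, k)) v :
  norm1 (A *m v) <= (\sum_i \sum_j `|A i j|) * norm1 v.
Proof.
rewrite mulr_suml; apply: ler_sum => i _; rewrite mxE mulr_suml.
apply: le_trans (ler_norm_sum _ _ _) _; apply: ler_sum => j _.
rewrite normrM ler_wpM2l// /norm1 (bigD1 j)//= lerDl; exact: sumr_ge0.
Qed.

Lemma near_norm1 k (v : 'cV[R]_k) (e : R) : 0 < e ->
  \forall w \near v, norm1 (w - v) < e.
Proof.
(* Dividing by [k.+1] covers [k = 0] and leaves the sum of [k] terms strictly below [e]. *)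
move=> e0; exists (fun i _ => [set x : R | `|x - v i 0| < e / k.+1%:R]).
  move=> i j; rewrite (ord1 j).
  have e1 : 0 < e / k.+1%:R by rewrite divr_gt0.
  near=> x; rewrite /= distrC; near: x.
  exact: (@cvgr_dist_lt _ _ _ (nbhs (v i 0)) _ id (v i 0)).
move=> w /= H; rewrite /norm1.
apply: (@le_lt_trans _ _ (\sum_(i < k) e / k.+1%:R)).
  by apply: ler_sum => i _; rewrite !mxE; exact/ltW/(H i 0).
rewrite sumr_const card_ord -[ltLHS]mulr_natr -mulrA gtr_pMr//.
by rewrite mulrC ltr_pdivrMr// mul1r ltr_nat.
Unshelve. all: by end_near. Qed.

Lemma lipschitz_norm1_continuous k (g : 'cV[R]_k -> R) C :
  (forall v w, `|g v - g w| <= C * norm1 (v - w)) -> continuous g.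
Proof.
move=> H v; apply/(@cvgrPdist_lt _ _ _ _ (nbhs_filter v)) => e e0.
have C1 : 0 < `|C| + 1 by rewrite ltr_wpDl.
near=> w; apply: le_lt_trans (H _ _) _.
apply: (@le_lt_trans _ _ ((`|C| + 1) * norm1 (w - v))).
  rewrite -norm1N opprB ler_wpM2r ?norm1_ge0//.
  by rewrite (le_trans (ler_norm C))// lerDl.
rewrite mulrC -ltr_pdivlMr//; near: w; apply: near_norm1.
by rewrite divr_gt0.
Unshelve. all: by end_near. Qed.

End SequentialContinuity.

Lemma bounded_integrable d (T : measurableType d) (R : realType)
    (P : probability T R) (f : T -> R) M :
  measurable_fun setT f -> (forall w, `|f w| <= M) ->
  P.-integrable setT (EFin \o f).
Proof.
move=> mf fM; apply: (@le_integrable _ _ _ _ _ _ _ (EFin \o cst M)) => //.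
- exact/measurable_EFinP.
- by move=> w _ /=; rewrite lee_fin (le_trans (fM w))// ler_norm.
- exact: finite_measure_integrable_cst.
Qed.

(** * Gaussian expectations and rotation invariance *)

Section GaussianExpectation.
Variable R : realType.
Implicit Types k : nat.

Local Notation mu := (@lebesgue_measure R).
Local Notation phi := (@normal_pdf R 0 1).

Lemma integrable_normal_pdfM (h : R -> R) (M : R) : measurable_fun setT h ->
  (forall x, `|h x| <= M) -> mu.-integrable setT (EFin \o (fun x => phi x * h x)).
Proof.
move=> mh hM; apply: (le_integrable (mu := mu) measurableT
  (g := fun x : measurableTypeR R => (M%:E * (phi x)%:E)%E)) => //.
- by apply/measurable_EFinP; apply: measurable_funM => //; exact: measurable_normal_pdf.
- move=> x _ /=; rewrite lee_fin normrM mulrC [leRHS]normrM ler_wpM2r//.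
  by rewrite (le_trans (hM x))// ler_norm.
- by apply: integrableZl => //; exact: integrable_normal_pdf.
Qed.

Lemma Rintegral_normal_pdfM_bound (h : R -> R) (M : R) : measurable_fun setT h ->
  (forall x, `|h x| <= M) -> `|\int[mu]_x (phi x * h x)| <= M.
Proof.
move=> mh hM; apply: le_trans; first apply: le_normr_Rintegral => //.
  exact: (integrable_normal_pdfM mh hM).
have -> : M = \int[mu]_x (phi x * M).
  rewrite RintegralZr//; last exact: integrable_normal_pdf.
  by rewrite /Rintegral integral_normal_pdf mul1r.
apply: le_Rintegral => //.
- exact: integrable_norm (integrable_normal_pdfM mh hM).
- exact: (@integrable_normal_pdfM (cst M) `|M|).
- by move=> x _; rewrite normrM ger0_norm ?normal_pdf_ge0// ler_wpM2l// normal_pdf_ge0.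
Qed.

Lemma cvg_Rintegral_normal_pdfM (h_ : nat -> R -> R) h (M : R) :
  (forall n, measurable_fun setT (h_ n)) -> (forall n x, `|h_ n x| <= M) ->
  (forall x, h_ n x @[n --> \oo] --> h x) ->
  \int[mu]_x (phi x * h_ n x) @[n --> \oo] --> \int[mu]_x (phi x * h x).
Proof.
move=> mh_ h_M h_h.
have mh : measurable_fun setT h.
  by apply: (@measurable_fun_cvg _ _ _ _ h_) => // x _; exact: h_h.
have hM x : `|h x| <= M.
  have /cvg_norm H := h_h x; rewrite -(cvg_lim _ H)//.
  by apply: limr_le; [apply/cvg_ex; exists `|h x| | apply: nearW].
apply: fine_cvg; rewrite fineK; last first.
  exact: integrable_fin_num (integrable_normal_pdfM mh hM).
apply: (@dominated_cvg _ _ _ mu setT _ _ _ (fun x => M%:E * (phi x)%:E)%E) => //.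
- move=> n; apply/measurable_EFinP; apply: measurable_funM => //.
    exact: measurable_normal_pdf.
  exact: mh_.
- by move=> x _; apply/fine_cvgP; split; [exact: nearW|apply: cvgMl_tmp; exact: h_h].
- by apply: integrableZl => //; exact: integrable_normal_pdf.
- move=> n x _; rewrite /= lee_fin normrM ger0_norm ?normal_pdf_ge0//.
  by rewrite mulrC ler_wpM2r// normal_pdf_ge0.
Qed.

Definition gauss_section k (g : 'cV[R]_k.+1 -> R) (x : R) : R :=
  gauss_exp (fun v : 'cV[R]_k => g (col_mx (x%:M : 'cV_1) v)).

Lemma gauss_expS k (g : 'cV[R]_k.+1 -> R) :
  gauss_exp g = \int[mu]_x (phi x * gauss_section g x).
Proof. by []. Qed.

Lemma seqcont_col_mx m k (g : 'cV[R]_(m + k) -> R) u :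
  seqcont g -> seqcont (fun v : 'cV[R]_k => g (col_mx u v)).
Proof. by move=> sg v v' vv'; apply/sg/ccvg_col_mx => //; exact: ccvg_cst. Qed.

(** The two claims need a joint induction: the convergence claim in dimension [k], applied along x_n
    -> x, makes the section of a function of [k.+1] variables continuous in its first variable,
    hence measurable; the bound in dimension [k] then supplies the domination for the outer
    integral. *)
Lemma gauss_exp_bound_cvg k :
  (forall (g : 'cV[R]_k -> R) (M : R), seqcont g -> (forall v, `|g v| <= M) ->
     `|gauss_exp g| <= M) /\
  (forall (g_ : nat -> 'cV[R]_k -> R) g (M : R), (forall n, seqcont (g_ n)) ->
     (forall n v, `|g_ n v| <= M) -> (forall v, g_ n v @[n --> \oo] --> g v) ->
     gauss_exp (g_ n) @[n --> \oo] --> gauss_exp g).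
Proof.
elim: k => [|k [IHb IHc]]; first by split=> [g M _|g_ g M _ _]; exact.
have csec (g : 'cV[R]_k.+1 -> R) (M : R) : seqcont g -> (forall v, `|g v| <= M) ->
    measurable_fun setT (gauss_section g).
  move=> sg gM; apply: continuous_measurable_fun; apply: seqcont_continuous => x l xl.
  apply: (IHc _ _ M) => // [n|v]; first exact: (@seqcont_col_mx 1).
  by apply/sg/(@ccvg_col_mx _ 1); [exact: ccvg_scalar|exact: ccvg_cst].
split=> [g M sg gM|g_ g M sg gM gg].
- rewrite gauss_expS; apply: Rintegral_normal_pdfM_bound; first exact: csec gM.
  by move=> x; apply: IHb => //; exact: (@seqcont_col_mx 1).
- apply: (@cvg_Rintegral_normal_pdfM (fun n => gauss_section (g_ n)) _ M).
  + by move=> n; exact: csec (gM n).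
  + by move=> n x; apply: IHb => //; exact: (@seqcont_col_mx 1).
  + by move=> x; apply: (IHc _ _ M) => // n; exact: (@seqcont_col_mx 1).
Qed.

Lemma gauss_exp_bound k (g : 'cV[R]_k -> R) (M : R) : seqcont g ->
  (forall v, `|g v| <= M) -> `|gauss_exp g| <= M.
Proof. exact: (gauss_exp_bound_cvg k).1. Qed.

Lemma cvg_gauss_exp k (g_ : nat -> 'cV[R]_k -> R) g (M : R) :
  (forall n, seqcont (g_ n)) -> (forall n v, `|g_ n v| <= M) ->
  (forall v, g_ n v @[n --> \oo] --> g v) ->
  gauss_exp (g_ n) @[n --> \oo] --> gauss_exp g.
Proof. exact: (gauss_exp_bound_cvg k).2. Qed.

Lemma gauss_section_bound k (g : 'cV[R]_k.+1 -> R) (M x : R) : seqcont g ->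
  (forall v, `|g v| <= M) -> `|gauss_section g x| <= M.
Proof. by move=> sg gM; apply: gauss_exp_bound => //; exact: (@seqcont_col_mx 1). Qed.

Lemma measurable_gauss_section k (g : 'cV[R]_k.+1 -> R) (M : R) : seqcont g ->
  (forall v, `|g v| <= M) -> measurable_fun setT (gauss_section g).
Proof.
move=> sg gM; apply: continuous_measurable_fun; apply: seqcont_continuous => x l xl.
apply: (@cvg_gauss_exp _ _ _ M) => // [n|v]; first exact: (@seqcont_col_mx 1).
by apply/sg/(@ccvg_col_mx _ 1); [exact: ccvg_scalar|exact: ccvg_cst].
Qed.

(** With [a = 1] it shifts a bounded function into the nonnegative range where Tonelli applies; with
    [a = -1] it turns lower bounds into upper bounds. *)
Lemma gauss_exp_affine k (g : 'cV[R]_k -> R) (M a c : R) : seqcont g ->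
  (forall v, `|g v| <= M) ->
  gauss_exp (fun v => a * g v + c) = a * gauss_exp g + c.
Proof.
elim: k g => [//|k IH] g sg gM; rewrite !gauss_expS.
have -> : (fun x => phi x * gauss_section (fun v => a * g v + c) x) =
    (fun x => a * (phi x * gauss_section g x) + phi x * c).
  apply/funext => x; rewrite /gauss_section IH//; last exact: (@seqcont_col_mx 1).
  by rewrite mulrDr mulrCA.
have H := integrable_normal_pdfM (measurable_gauss_section sg gM)
  (fun x => gauss_section_bound x sg gM).
rewrite RintegralD//; last 2 first.
- exact: (integrableZl _ a H).
- exact: (@integrable_normal_pdfM (cst c) `|c|).
rewrite RintegralZl//; congr (_ + _).
rewrite RintegralZr//; last exact: integrable_normal_pdf.
by rewrite /Rintegral integral_normal_pdf mul1r.
Qed.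

(** The image of Lebesgue measure under a translation gives half-open intervals their length, and
    this determines the measure. *)
Lemma ge0_integral_translation (h : R -> \bar R) (c : R) :
  measurable_fun setT h -> (forall x, 0 <= h x)%E ->
  (\int[mu]_x h (x + c)%R = \int[mu]_x h x)%E.
Proof.
move=> mh h0.
pose f : measurableTypeR R -> measurableTypeR R := fun x => x + c.
have mf : measurable_fun setT f by exact: measurable_funD.
have := @ge0_integral_pushforward _ _ (measurableTypeR R) (measurableTypeR R) R
  f mf (@lebesgue_measure R) setT h measurableT mh (fun x _ => h0 x).
rewrite preimage_setT => <-.
apply: eq_measure_integral => A mA _; apply/esym.
apply: (@lebesgue_measure_unique R (pushforward (@lebesgue_measure R) f)) => //.
move=> _ [[a b] _ <-]; rewrite /pushforward.
have E : f @^-1` `]a, b]%classic = `]a - c, b - c]%classic.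
  by apply/seteqP; split => x /=; rewrite !in_itv /= /f ltrBlDr lerBrDr.
transitivity (mu `]a - c, b - c]%classic); last by rewrite -E.
by rewrite !lebesgue_measure_itv /= !lte_fin ltrD2r -!EFinB opprB addrA subrK.
Qed.

Lemma measurable_shearl (b : R) :
  measurable_fun setT (fun z : R * R => (z.1 + b * z.2, z.2)).
Proof.
by apply: measurable_fun_pair => //; apply: measurable_funD => //; apply: measurable_funM.
Qed.

Lemma measurable_shearr (a : R) :
  measurable_fun setT (fun z : R * R => (z.1, z.2 + a * z.1)).
Proof.
by apply: measurable_fun_pair => //; apply: measurable_funD => //; apply: measurable_funM.
Qed.

Lemma ge0_integral_shearr (H : R * R -> \bar R) (a : R) :
  measurable_fun setT H -> (forall z, 0 <= H z)%E ->
  (\int[mu]_x \int[mu]_y H (x, y + a * x)%R = \int[mu]_x \int[mu]_y H (x, y))%E.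
Proof.
move=> mH H0; apply: eq_integral => x _.
apply: (@ge0_integral_translation (fun y => H (x, y))) => //.
exact: measurable_fun_pair2.
Qed.

(** Here the translated variable is the outer one, so Tonelli exchanges the integrals before and
    after the translation. *)
Lemma ge0_integral_shearl (H : R * R -> \bar R) (b : R) :
  measurable_fun setT H -> (forall z, 0 <= H z)%E ->
  (\int[mu]_x \int[mu]_y H (x + b * y, y)%R = \int[mu]_x \int[mu]_y H (x, y))%E.
Proof.
move=> mH H0.
rewrite (@fubini_tonelli _ _ (measurableTypeR R) (measurableTypeR R) R mu mu
  (fun z : R * R => H (z.1 + b * z.2, z.2)%R))//; last first.
  exact: measurableT_comp mH (measurable_shearl b).
rewrite [RHS](@fubini_tonelli _ _ (measurableTypeR R) (measurableTypeR R) R mu mu H)//.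
apply: eq_integral => y _ /=.
apply: (@ge0_integral_translation (fun x => H (x, y))) => //.
exact: measurable_fun_pair1.
Qed.

(* A rotation of angle other than pi is a product of three shears. *)
Lemma ge0_integral_rotation (H : R * R -> \bar R) (c s : R) :
  c ^+ 2 + s ^+ 2 = 1 -> c != -1 ->
  measurable_fun setT H -> (forall z, 0 <= H z)%E ->
  (\int[mu]_x \int[mu]_y H (c * x - s * y, s * x + c * y)%R =
   \int[mu]_x \int[mu]_y H (x, y))%E.
Proof.
move=> cs c1 mH H0; have c0 : 1 + c != 0 by rewrite addrC -[1]opprK subr_eq0.
(* For c = cos a and s = sin a this is - tan (a / 2): the rotation is the shear by [t] along x, then
   by [s] along y, then by [t] along x again. *)
pose t := - (s / (1 + c)).
have mX := measurable_shearl t; have mY := measurable_shearr s.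
pose H1 := fun z : R * R => H (z.1 + t * z.2, z.2).
pose H2 := fun z : R * R => H1 (z.1, z.2 + s * z.1).
have mH1 : measurable_fun setT H1 by exact: measurableT_comp mH mX.
have mH2 : measurable_fun setT H2 by exact: measurableT_comp mH1 mY.
rewrite -(ge0_integral_shearl t mH H0) -(ge0_integral_shearr s mH1 (fun=> H0 _)).
rewrite -(ge0_integral_shearl t mH2 (fun=> H0 _)).
apply: eq_integral => x _; apply: eq_integral => y _; rewrite /H2 /H1 /=.
congr (H _); have E : s ^+ 2 = 1 - c ^+ 2 by rewrite -cs addrAC subrr add0r.
have st : s * t = c - 1.
  by rewrite /t mulrN mulrA -expr2 E -{1}(expr1n _ 2) subr_sqr mulfK// opprB.
have ct : c * t = - s - t.
  by rewrite /t; field.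
congr pair; last by rewrite mulrDr mulrA st; ring.
transitivity (x + t * y + t * y + s * t * x + s * t * (t * y)); last by ring.
rewrite st; transitivity (c * x + t * y + c * t * y); last by ring.
rewrite ct; ring.
Qed.

End GaussianExpectation.

(** * Orthogonal invariance of the standard Gaussian and square factors *)

Section GaussianInvariance.
Variable R : realType.
Implicit Types k m : nat.

Local Notation mu := (@lebesgue_measure R).
Local Notation phi := (@normal_pdf R 0 1).

Lemma normal_pdfM_sqr (x y x' y' : R) : x ^+ 2 + y ^+ 2 = x' ^+ 2 + y' ^+ 2 ->
  phi x * phi y = phi x' * phi y'.
Proof.
move=> E; rewrite normal_pdfE// /normal_fun !subr0.
rewrite mulrACA [RHS]mulrACA -!expRD; congr (_ * expR _).
by rewrite -!mulrDl -!opprD E.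
Qed.

(** Rotation in the plane of the first two coordinates. The nested blocks follow the way [gauss_exp]
    peels off one coordinate at a time. *)
Definition rot2 k (c s : R) : 'M[R]_(1 + (1 + k)) :=
  block_mx (c%:M : 'M[R]_1) (row_mx (- s)%:M 0 : 'M[R]_(1, 1 + k))
    (col_mx s%:M 0 : 'M[R]_(1 + k, 1)) (block_mx c%:M 0 0 1%:M).

Lemma mul_rot2 k (c s x y : R) (v : 'cV[R]_k) :
  rot2 k c s *m col_mx x%:M (col_mx y%:M v) =
  col_mx (c * x - s * y)%:M (col_mx (s * x + c * y)%:M v).
Proof.
rewrite /rot2 mul_block_col mul_row_col mul_col_mx mul_block_col !mul0mx !addr0.
rewrite add_col_mx mul1mx !add0r -!scalar_mxM -!raddfD /=.
by rewrite mulNr.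
Qed.

Lemma rot2_orthogonal k (c s : R) : c ^+ 2 + s ^+ 2 = 1 ->
  rot2 k c s *m (rot2 k c s)^T = 1%:M.
Proof.
move=> cs; rewrite /rot2 tr_block_mx mulmx_block tr_row_mx tr_col_mx tr_block_mx.
rewrite !trmx0 !tr_scalar_mx mul_row_col mul_col_mx mul_row_block mul_mx_row.
rewrite mul_block_col mul_col_row mulmx_block.
rewrite !mul0mx !mulmx0 !addr0 !add0r mulmx1 -!scalar_mxM.
rewrite add_row_mx add_col_mx add_block_mx !addr0 !add0r -!raddfD /=.
rewrite mulrNN -!expr2 [s ^+ 2 + _]addrC cs mulrN mulNr [s * c]mulrC subrr raddf0.
by rewrite col_mx0 row_mx0 -!scalar_mx_block.
Qed.

Definition gauss_section2 k (g : 'cV[R]_k.+2 -> R) (x y : R) : R :=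
  gauss_exp (fun v : 'cV[R]_k => g (col_mx (x%:M : 'cV_1) (col_mx (y%:M : 'cV_1) v))).

(** Joint measurability in the pair, as Tonelli requires, comes from joint sequential continuity;
    the pair is repackaged as a vector of length 2 to apply [measurable_seqcont_comp]. *)
Lemma measurable_gauss_section2 k (g : 'cV[R]_k.+2 -> R) (M : R) : seqcont g ->
  (forall v, `|g v| <= M) ->
  measurable_fun setT (fun z : R * R => gauss_section2 g z.1 z.2).
Proof.
move=> sg gM.
pose V (z : R * R) : 'cV[R]_2 := \col_i (if i == 0 then z.1 else z.2).
pose f (u : 'cV[R]_2) := gauss_section2 g (u 0 0) (u 1 0).
have -> : (fun z : R * R => gauss_section2 g z.1 z.2) = (fun z => f (V z)).
  by apply/funext => z; rewrite /f !mxE.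
apply: measurable_seqcont_comp => [i|].
  under eq_fun do rewrite mxE.
  by case: (i == 0); [exact: measurable_fst|exact: measurable_snd].
move=> u v uv; apply: (@cvg_gauss_exp _ _ _ _ M) => [n|n w|w] //.
- move=> a b ab; apply: sg; apply: (@ccvg_col_mx _ 1); first exact: ccvg_cst.
  by apply: (@ccvg_col_mx _ 1) => //; exact: ccvg_cst.
- apply: sg; apply: (@ccvg_col_mx _ 1); first exact: ccvg_scalar.
  by apply: (@ccvg_col_mx _ 1); [exact: ccvg_scalar|exact: ccvg_cst].
Qed.

Lemma gauss_section2_bound k (g : 'cV[R]_k.+2 -> R) (M x y : R) : seqcont g ->
  (forall v, `|g v| <= M) -> `|gauss_section2 g x y| <= M.
Proof.
move=> sg gM; apply: gauss_exp_bound => //.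
exact: (@seqcont_col_mx R 1 k _ y%:M (@seqcont_col_mx R 1 k.+1 g x%:M sg)).
Qed.

(** Positivity follows from the bound alone: values in [0, M] mean |g - M/2| <= M/2, hence |E g -
    M/2| <= M/2. *)
Lemma gauss_section2_ge0 k (g : 'cV[R]_k.+2 -> R) (M x y : R) : seqcont g ->
  (forall v, 0 <= g v <= M) -> 0 <= gauss_section2 g x y.
Proof.
move=> sg gM.
have sh : seqcont (fun v : 'cV[R]_k => g (col_mx (x%:M : 'cV_1) (col_mx (y%:M : 'cV_1) v))).
  exact: (@seqcont_col_mx R 1 k _ y%:M (@seqcont_col_mx R 1 k.+1 g x%:M sg)).
have sh' : seqcont (fun v : 'cV[R]_k => 1 * g (col_mx (x%:M : 'cV_1) (col_mx (y%:M : 'cV_1) v))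
    + - (M / 2)).
  by move=> u v uv; apply: cvgD; [apply: cvgMl_tmp; exact: sh|exact: cvg_cst].
have := @gauss_exp_bound _ _ _ (M / 2) sh'.
rewrite (@gauss_exp_affine _ _ _ M)//; last first.
  by move=> v; have /andP[g0 g1] := gM (col_mx x%:M (col_mx y%:M v)); rewrite ger0_norm.
rewrite -/(gauss_section2 g x y) mul1r => H.
suff /H : forall v : 'cV[R]_k,
    `|1 * g (col_mx x%:M (col_mx y%:M v)) - M / 2| <= M / 2.
  by rewrite ler_norml => /andP[H1 _]; lra.
move=> v; have /andP[g0 g1] := gM (col_mx x%:M (col_mx y%:M v)).
by rewrite mul1r ler_norml; apply/andP; split; lra.
Qed.

(** Moves the two outer real integrals to the extended reals, where the shear lemmas are stated, and
    joins the two densities into a factor depending only on x^2 + y^2. *)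
Lemma gauss_exp_iterated k (g : 'cV[R]_k.+2 -> R) (M : R) : seqcont g ->
  (forall v, 0 <= g v <= M) ->
  ((gauss_exp g)%:E =
   \int[mu]_x \int[mu]_y (phi x * phi y * gauss_section2 g x y)%:E)%E.
Proof.
move=> sg gM.
have gM' v : `|g v| <= M by have /andP[g0 g1] := gM v; rewrite ger0_norm.
have int1 := integrable_normal_pdfM (measurable_gauss_section sg gM')
  (fun x => gauss_section_bound x sg gM').
rewrite gauss_expS /Rintegral fineK; last exact: integrable_fin_num int1.
apply: eq_integral => x _.
have m2 : measurable_fun setT (gauss_section2 g x).
  exact: (measurableT_comp (measurable_gauss_section2 sg gM') (measurable_pair1 x)).
have int2 := integrable_normal_pdfM m2 (fun y => gauss_section2_bound x y sg gM').
rewrite EFinM /gauss_section gauss_expS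
  -[X in (_ * X%:E)%E]/(\int[mu]_y (phi y * gauss_section2 g x y)).
rewrite /Rintegral fineK; last exact: integrable_fin_num int2.
rewrite -integralZl//; apply: eq_integral => y _.
by rewrite -EFinM mulrA.
Qed.

Lemma gauss_exp_rot2_ge0 k (c s : R) (g : 'cV[R]_k.+2 -> R) (M : R) :
  c ^+ 2 + s ^+ 2 = 1 -> c != -1 -> seqcont g -> (forall v, 0 <= g v <= M) ->
  gauss_exp (fun z => g (rot2 k c s *m z)) = gauss_exp g.
Proof.
move=> cs c1 sg gM; apply: EFin_inj.
have gMr z : 0 <= g (rot2 k c s *m z) <= M by exact: gM.
apply: (etrans (gauss_exp_iterated (seqcont_mulmx (A := rot2 k c s) sg) gMr)).
apply: (etrans _ (esym (gauss_exp_iterated sg gM))).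
have gM' v : `|g v| <= M by have /andP[g0 g1] := gM v; rewrite ger0_norm.
pose H (z : R * R) := ((phi z.1 * phi z.2 * gauss_section2 g z.1 z.2)%:E)%E.
rewrite -[RHS](@ge0_integral_rotation _ H _ _ cs c1) /H.
- apply: eq_integral => x _; apply: eq_integral => y _ /=.
  rewrite (@normal_pdfM_sqr x y (c * x - s * y) (s * x + c * y)); last first.
    transitivity ((c ^+ 2 + s ^+ 2) * (x ^+ 2 + y ^+ 2)); last by ring.
    by rewrite cs mul1r.
  congr ((_ * gauss_exp _)%:E); apply/funext => v; congr (g _).
  exact: mul_rot2.
- apply/measurable_EFinP; apply: measurable_funM; last exact: measurable_gauss_section2 sg gM'.
  by apply: measurable_funM; apply: measurableT_comp (measurable_normal_pdf _ _) _.
- move=> z; rewrite lee_fin mulr_ge0//; last exact: gauss_section2_ge0 gM.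
  by rewrite mulr_ge0 ?normal_pdf_ge0.
Qed.

Definition gauss_invariant k (Q : 'M[R]_k) : Prop :=
  forall (g : 'cV[R]_k -> R) (M : R), seqcont g -> (forall v, `|g v| <= M) ->
    gauss_exp (fun z => g (Q *m z)) = gauss_exp g.

Lemma gauss_invariant1 k : gauss_invariant (1%:M : 'M[R]_k).
Proof. by move=> g M _ _; congr gauss_exp; apply/funext => z; rewrite mul1mx. Qed.

Lemma gauss_invariantM k (Q Q' : 'M[R]_k) :
  gauss_invariant Q -> gauss_invariant Q' -> gauss_invariant (Q *m Q').
Proof.
move=> iQ iQ' g M sg gM; rewrite -(iQ g M sg gM).
rewrite -(iQ' _ M (seqcont_mulmx (A := Q) sg) (fun=> gM _)).
by congr gauss_exp; apply/funext => z; rewrite mulmxA.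
Qed.

(** Adding [M] reduces to a function with values in [0, 2M]; the constant is removed from both sides
    afterwards. *)
Lemma gauss_invariant_rot2 k (c s : R) : c ^+ 2 + s ^+ 2 = 1 -> c != -1 ->
  gauss_invariant (rot2 k c s).
Proof.
move=> cs c1 g M sg gM.
have sg1 : seqcont (fun v => 1 * g v + M).
  by move=> u v uv; apply: cvgD; [apply: cvgMl_tmp; exact: sg|exact: cvg_cst].
have := gauss_exp_rot2_ge0 (M := M + M) cs c1 sg1.
move: (rot2 k c s) => Q H; apply: (addIr M).
have aff (h : 'cV[R]_k.+2 -> R) : seqcont h -> (forall v, `|h v| <= M) ->
    gauss_exp h + M = gauss_exp (fun v => 1 * h v + M).
  by move=> sh hM; rewrite (gauss_exp_affine 1 M sh hM) mul1r.
apply: (etrans (aff (fun z => g (Q *m z)) (seqcont_mulmx sg) (fun=> gM _))).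
apply: (etrans _ (esym (aff _ sg gM))).
apply: H => v.
by have := gM v; rewrite ler_norml mul1r => /andP[? ?]; apply/andP; split; lra.
Qed.

Lemma gauss_invariant_block k (Q : 'M[R]_k) : gauss_invariant Q ->
  gauss_invariant (block_mx (1%:M : 'M[R]_1) 0 0 Q : 'M[R]_(1 + k)).
Proof.
move=> iQ g M sg gM; rewrite !gauss_expS; apply: eq_Rintegral => x _; congr (_ * _).
rewrite /gauss_section -(iQ _ M (@seqcont_col_mx R 1 k g x%:M sg))//.
congr gauss_exp; apply/funext => v.
by rewrite (@mul_block_col _ 1 k 1 k 1) !mul0mx addr0 add0r mul1mx.
Qed.

(** Polar coordinates with a signed radius: giving [r] the sign of [a] keeps the cosine nonnegative,
    away from the excluded half-turn. *)
Lemma plane_rotation (a b : R) : exists c s r : R,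
  [/\ c ^+ 2 + s ^+ 2 = 1, c != -1, c * r = a & s * r = b].
Proof.
pose r0 := Num.sqrt (a ^+ 2 + b ^+ 2).
have r2 : r0 ^+ 2 = a ^+ 2 + b ^+ 2 by rewrite sqr_sqrtr ?addr_ge0 ?sqr_ge0.
have [r00|r00] := eqVneq r0 0.
  have /eqP := r2; rewrite r00 expr0n /= eq_sym paddr_eq0 ?sqr_ge0// !sqrf_eq0.
  move=> /andP[/eqP -> /eqP ->]; exists 1, 0, 0.
  by rewrite !mulr0 expr1n expr0n addr0 -subr_eq0 opprK; split => //; rewrite pnatr_eq0.
pose r := if 0 <= a then r0 else - r0.
have rr : r ^+ 2 = a ^+ 2 + b ^+ 2 by rewrite /r; case: ifP; rewrite ?sqrrN.
have r_neq0 : r != 0 by rewrite /r; case: ifP; rewrite ?oppr_eq0.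
exists (a / r), (b / r), r; split; rewrite ?divfK//.
  by rewrite !expr_div_n -mulrDl -rr divff// expf_neq0.
suff : 0 <= a / r by apply: contraTneq => ->; rewrite -ltNge ltrN10.
rewrite /r; case: ifPn => a0; first by rewrite divr_ge0// sqrtr_ge0.
by rewrite invrN mulrN -mulNr divr_ge0 ?sqrtr_ge0// oppr_ge0 ltW// ltNge.
Qed.

Definition basis1 k : 'cV[R]_k.+1 := col_mx (1%:M : 'cV_1) 0.

(* Givens rotations bring any vector onto the first axis. *)
Lemma gauss_invariant_to_axis k (u : 'cV[R]_k.+1) : exists (Q : 'M[R]_k.+1) (a : R),
  [/\ gauss_invariant Q, Q *m Q^T = 1%:M & u = a *: (Q *m basis1 k)].
Proof.
elim: k u => [|k IH] u.
  exists 1%:M, (u 0 0); split; [exact: gauss_invariant1|by rewrite trmx1 mulmx1|].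
  rewrite mul1mx; apply/matrixP => i j; rewrite !ord1 /basis1 !mxE.
  by case: (splitP _) => [l _|[]//]; rewrite ord1 mxE mulr1.
have [Q [a [iQ oQ ua]]] := IH (dsubmx (u : 'cV_(1 + k.+1))).
have [c [s [r [cs c1 cr sr]]]] := plane_rotation ((usubmx (u : 'cV_(1 + k.+1))) 0 0) a.
(* [rot2] sends [r] times the first basis vector to (u_0, a, 0, ..., 0), and [B] then sends (a, 0,
   ..., 0) in the lower block to the tail of [u]. *)
pose B : 'M[R]_k.+2 := block_mx (1%:M : 'M[R]_1) 0 0 Q.
exists (B *m rot2 k c s), r; split.
- by apply: gauss_invariantM; [exact: gauss_invariant_block|exact: gauss_invariant_rot2].
- rewrite trmx_mul mulmxA -(mulmxA B) rot2_orthogonal// mulmx1.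
  rewrite /B (@tr_block_mx _ 1 k.+1 1 k.+1) (@mulmx_block _ 1 k.+1 1 k.+1 1 k.+1)
    !trmx0 !mul0mx !mulmx0 trmx1 mulmx1 oQ !addr0 add0r.
  by rewrite -(@scalar_mx_block _ 1 k.+1).
- have E : basis1 k.+1 = col_mx 1%:M (col_mx (0%:M : 'M[R]_1) (0 : 'cV_k)).
    by rewrite /basis1 raddf0 col_mx0.
  rewrite -mulmxA E mul_rot2 !mulr0 subr0 addr0 !mulr1.
  rewrite /B (@mul_block_col _ 1 k.+1 1 k.+1 1) !mul0mx addr0 add0r mul1mx.
  rewrite (@scale_col_mx _ 1 k.+1 1) scale_scalar_mx mulrC cr.
  have -> : col_mx s%:M 0 = s *: basis1 k :> 'cV_(1 + k).
    by rewrite /basis1 (@scale_col_mx _ 1 k 1) scaler0 scale_scalar_mx mulr1.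
  rewrite -scalemxAr scalerA mulrC sr -ua.
  by rewrite -mx11_scalar (@vsubmxK _ 1 k.+1 1).
Qed.

Definition same_gauss_image m k j (L : 'M[R]_(m, k)) (N : 'M[R]_(m, j)) : Prop :=
  forall (g : 'cV[R]_m -> R) (M : R), seqcont g -> (forall v, `|g v| <= M) ->
    gauss_exp (fun z => g (L *m z)) = gauss_exp (fun z => g (N *m z)).

Lemma gauss_exp_drop m k (L : 'M[R]_(m, k.+1)) : (m <= k)%N ->
  exists2 N : 'M[R]_(m, k), N *m N^T = L *m L^T & same_gauss_image L N.
Proof.
move=> mk.
have [u u0 Lu] : exists2 u : 'cV[R]_k.+1, u != 0 & L *m u = 0.
  have : kermx L^T != 0.
    rewrite kermx_eq0 /row_free mxrank_tr neq_ltn.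
    by rewrite (leq_ltn_trans (rank_leq_row _)).
  move=> /rowV0Pn[w wK w0]; exists w^T; first by rewrite trmx_eq0.
  by apply: trmx_inj; rewrite trmx_mul trmxK trmx0; exact/sub_kermxP.
have [Q [a [iQ oQ ua]]] := gauss_invariant_to_axis u.
have a0 : a != 0 by apply: contra_neq u0 => a0; rewrite ua a0 scale0r.
have LQ : (L *m Q) *m basis1 k = 0.
  have /eqP := Lu; rewrite ua -scalemxAr scaler_eq0 (negbTE a0) mulmxA.
  by move/eqP.
pose K : 'M[R]_(m, 1 + k) := L *m Q.
have KE : K = row_mx 0 (rsubmx K).
  rewrite -[LHS]hsubmxK; congr row_mx.
  by move: LQ; rewrite -/K /basis1 -[K]hsubmxK
    (@mul_row_col _ m 1 k 1) mulmx1 mulmx0 addr0 row_mxKl.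
exists (rsubmx K).
  transitivity (K *m K^T).
    by rewrite [in RHS]KE tr_row_mx mul_row_col trmx0 mulmx0 add0r.
  by rewrite /K trmx_mul mulmxA -(mulmxA L) oQ mulmx1.
move=> g M sg gM; rewrite -(iQ _ M (seqcont_mulmx (A := L) sg))//.
rewrite gauss_expS (_ : gauss_section _ = cst (gauss_exp (fun z => g (rsubmx K *m z)))).
  rewrite RintegralZr//; last exact: integrable_normal_pdf.
  by rewrite /Rintegral integral_normal_pdf mul1r.
apply/funext => x; congr gauss_exp; apply/funext => v; congr (g _).
by rewrite mulmxA -/K [in LHS]KE (@mul_row_col _ m 1 k 1) mul0mx add0r.
Qed.

Lemma gauss_exp_square m j (L : 'M[R]_(m, j + m)) :
  exists2 N : 'M[R]_m, N *m N^T = L *m L^T & same_gauss_image L N.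
Proof.
elim: j L => [|j IH] L; first by exists L.
have [L1 [E1 H1]] := gauss_exp_drop L (leq_addl j m).
have [L2 [E2 H2]] := IH L1; exists L2; first by rewrite E2.
by move=> g M sg gM; rewrite (H1 g M)// (H2 g M).
Qed.

End GaussianInvariance.

(** * Independence and the weak law of large numbers *)

Section NonnegativeExpectation.
Context {R : realType} {d : measure_display} {T : measurableType d}.
Variable P : probability T R.
Implicit Types f g : T -> R.

(** Expectation in the extended reals, used for nonnegative [f]: an upper bound by a real number
    then carries integrability with it. *)
Definition eexp f : \bar R := (\int[P]_w (f w)%:E)%E.

Lemma eexp_ge0 f : (forall w, 0 <= f w) -> (0 <= eexp f)%E.
Proof. by move=> f0; apply: integral_ge0 => w _; rewrite lee_fin. Qed.

Lemma eexp_le f g : measurable_fun setT f -> measurable_fun setT g ->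
  (forall w, 0 <= f w) -> (forall w, f w <= g w) -> (eexp f <= eexp g)%E.
Proof.
move=> mf mg f0 fg; apply: ge0_le_integral => //.
- by move=> w _; rewrite lee_fin.
- exact/measurable_EFinP.
- exact/measurable_EFinP.
- by move=> w _; rewrite lee_fin.
Qed.

Lemma eexpD f g : measurable_fun setT f -> measurable_fun setT g ->
  (forall w, 0 <= f w) -> (forall w, 0 <= g w) ->
  eexp (fun w => f w + g w) = (eexp f + eexp g)%E.
Proof.
move=> mf mg f0 g0; rewrite /eexp -ge0_integralD//.
- by move=> w _; rewrite lee_fin.
- exact/measurable_EFinP.
- by move=> w _; rewrite lee_fin.
- exact/measurable_EFinP.
Qed.

Lemma eexpZ a f : measurable_fun setT f -> (forall w, 0 <= f w) -> 0 <= a ->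
  eexp (fun w => a * f w) = (a%:E * eexp f)%E.
Proof.
move=> mf f0 a0; rewrite /eexp -ge0_integralZl//.
- exact/measurable_EFinP.
- by move=> w _; rewrite lee_fin.
Qed.

Lemma eexp_sum (I : Type) (s : seq I) (F : I -> T -> R) :
  (forall i, measurable_fun setT (F i)) -> (forall i w, 0 <= F i w) ->
  eexp (fun w => \sum_(i <- s) F i w) = (\sum_(i <- s) eexp (F i))%E.
Proof.
move=> mF F0; rewrite /eexp -ge0_integral_sum//.
- by apply: eq_integral => w _; rewrite sumEFin.
- by move=> i; exact/measurable_EFinP.
- by move=> i w _; rewrite lee_fin.
Qed.

Lemma eexp_cst (a : R) : eexp (cst a) = a%:E.
Proof.
rewrite /eexp -[LHS]/(\int[P]_w (cst a%:E) w)%E integral_cst//.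
by transitivity (a%:E * 1%:E)%E; [congr (_ * _)%E; exact: probability_setT|rewrite mule1].
Qed.

Lemma Rintegral_cst_probability (a : R) : \int[P]_w (cst a w) = a.
Proof. by rewrite /Rintegral -/(eexp (cst a)) eexp_cst. Qed.

Lemma eexp_EFin f (M : R) : measurable_fun setT f -> (forall w, `|f w| <= M) ->
  eexp f = (\int[P]_w f w)%:E.
Proof.
move=> mf fM; rewrite /Rintegral fineK//.
apply: integrable_fin_num => //; exact: bounded_integrable mf fM.
Qed.

Lemma ge0_integral_same_law d1 (T1 : measurableType d1) (X Y : T -> T1) (f : T1 -> \bar R) :
  measurable_fun setT X -> measurable_fun setT Y ->
  (forall A, measurable A -> P (X @^-1` A) = P (Y @^-1` A)) ->
  measurable_fun setT f -> (forall x, 0 <= f x)%E ->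
  (\int[P]_w f (X w) = \int[P]_w f (Y w))%E.
Proof.
move=> mX mY XY mf f0.
have := ge0_integral_pushforward mX P measurableT mf (fun x _ => f0 x).
rewrite preimage_setT => <-.
have := ge0_integral_pushforward mY P measurableT mf (fun x _ => f0 x).
rewrite preimage_setT => <-.
by apply: eq_measure_integral => A mA _; exact: XY.
Qed.

Lemma Rintegral_same_law d1 (T1 : measurableType d1) (X Y : T -> T1) (f : T1 -> R) :
  measurable_fun setT X -> measurable_fun setT Y ->
  (forall A, measurable A -> P (X @^-1` A) = P (Y @^-1` A)) ->
  measurable_fun setT f ->
  \int[P]_w f (X w) = \int[P]_w f (Y w).
Proof.
move=> mX mY XY mf; rewrite /Rintegral; congr fine.
have mE : measurable_fun setT (EFin \o f) by exact/measurable_EFinP.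
have posE (Z : T -> T1) w : (fun w => (f (Z w))%:E)^\+%E w = (EFin \o f)^\+%E (Z w).
  by rewrite !funepos.unlock.
have negE (Z : T -> T1) w : (fun w => (f (Z w))%:E)^\-%E w = (EFin \o f)^\-%E (Z w).
  by rewrite !funeneg.unlock.
rewrite integralE [RHS]integralE; congr (_ - _)%E.
- under eq_integral do rewrite posE; under [RHS]eq_integral do rewrite posE.
  exact: ge0_integral_same_law (measurable_funepos mE) (funepos_ge0 _).
- under eq_integral do rewrite negE; under [RHS]eq_integral do rewrite negE.
  exact: ge0_integral_same_law (measurable_funeneg mE) (funeneg_ge0 _).
Qed.

(** Independence says that the law of the pair agrees with the product of the laws on rectangles,
    hence everywhere; Tonelli then factors the integral. *)
Lemma indep_eexpM d1 (T1 : measurableType d1) d2 (T2 : measurableType d2)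
    (X : T -> T1) (Y : T -> T2) (f : T1 -> R) (g : T2 -> R) :
  measurable_fun setT X -> measurable_fun setT Y ->
  (forall A B, measurable A -> measurable B ->
     P (X @^-1` A `&` Y @^-1` B) = (P (X @^-1` A) * P (Y @^-1` B))%E) ->
  measurable_fun setT f -> measurable_fun setT g ->
  (forall x, 0 <= f x) -> (forall y, 0 <= g y) ->
  eexp (fun w => f (X w) * g (Y w)) = (eexp (f \o X) * eexp (g \o Y))%E.
Proof.
move=> mX mY XY mf mg f0 g0.
pose Xm : {mfun T >-> T1} := HB.pack X (isMeasurableFun.Build _ _ _ _ _ mX).
pose Ym : {mfun T >-> T2} := HB.pack Y (isMeasurableFun.Build _ _ _ _ _ mY).
have mZ : measurable_fun setT (fun w => (X w, Y w)) by exact: measurable_fun_pair.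
pose Zm : {mfun T >-> (T1 * T2)%type} :=
  HB.pack (fun w => (X w, Y w)) (isMeasurableFun.Build _ _ _ _ _ mZ).
pose F (z : T1 * T2) : \bar R := (f z.1 * g z.2)%:E.
have mF : measurable_fun setT F.
  by apply/measurable_EFinP; apply: measurable_funM; exact: measurableT_comp.
have F0 z : (0 <= F z)%E by rewrite lee_fin mulr_ge0.
have transX (h : T1 -> \bar R) : measurable_fun setT h -> (forall x, 0 <= h x)%E ->
    (\int[P]_w h (X w) = \int[distribution P Xm]_x h x)%E.
  move=> mh h0; have := ge0_integral_pushforward mX P measurableT mh (fun x _ => h0 x).
  by rewrite preimage_setT => <-.
have transY (h : T2 -> \bar R) : measurable_fun setT h -> (forall x, 0 <= h x)%E ->
    (\int[P]_w h (Y w) = \int[distribution P Ym]_x h x)%E.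
  move=> mh h0; have := ge0_integral_pushforward mY P measurableT mh (fun x _ => h0 x).
  by rewrite preimage_setT => <-.
have -> : eexp (fun w => f (X w) * g (Y w)) = (\int[distribution P Zm]_z F z)%E.
  have H := ge0_integral_pushforward mZ P measurableT mF (fun x _ => F0 x).
  by rewrite preimage_setT in H; rewrite [RHS]H.
have -> : (\int[distribution P Zm]_z F z =
    \int[(distribution P Xm \x distribution P Ym)%E]_z F z)%E.
  apply: eq_measure_integral => A mA _; apply/esym.
  apply: (@product_measure_unique _ _ _ _ _ (distribution P Xm) (distribution P Ym)
    (distribution P Zm)) => //.
rewrite fubini_tonelli1//.
rewrite /eexp (transX (EFin \o f)) ?(transY (EFin \o g));
  try exact/measurable_EFinP; rewrite ?lee_fin//.
have Ef0 x : True -> (0 <= (f x)%:E)%E by rewrite lee_fin.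
have Eg0 : (0 <= \int[distribution P Ym]_x (EFin \o g) x)%E.
  by apply: integral_ge0 => y _; rewrite lee_fin.
have mEf : measurable_fun setT (EFin \o f) by exact/measurable_EFinP.
rewrite -ge0_integralZr//; apply: eq_integral => x _.
have mEg : measurable_fun setT (EFin \o g) by exact/measurable_EFinP.
have Eg y : True -> (0 <= (EFin \o g) y)%E by rewrite lee_fin.
have Ef : (0 <= (EFin \o f) x)%E by rewrite lee_fin.
by rewrite /fubini_F -ge0_integralZl.
Qed.

End NonnegativeExpectation.

(** * Weak law of large numbers in mean, by truncation *)

Section WeakLaw.
Context {R : realType} {d : measure_display} {T : measurableType d}.
Variable P : probability T R.

Lemma Rintegral_sum (I : Type) (s : seq I) (F : I -> T -> R) :
  (forall i, P.-integrable setT (EFin \o F i)) ->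
  \int[P]_w (\sum_(i <- s) F i w) = \sum_(i <- s) \int[P]_w F i w.
Proof.
move=> iF; elim: s => [|i s IH].
  rewrite big_nil; under eq_Rintegral do rewrite big_nil.
  exact: (Rintegral_cst_probability P).
rewrite big_cons -IH -RintegralD//; first by apply: eq_Rintegral => w _; rewrite big_cons.
under [X in _.-integrable _ X]eq_fun do rewrite /= -sumEFin.
apply: integrable_sum => // j _; exact: iF.
Qed.

(** The nonnegative case is applied to [f + M] and [g + M]; expanding both sides leaves the product
    formula for [f] and [g]. *)
Lemma indep_RintegralM d1 (T1 : measurableType d1) d2 (T2 : measurableType d2)
    (X : T -> T1) (Y : T -> T2) (f : T1 -> R) (g : T2 -> R) (M : R) :
  measurable_fun setT X -> measurable_fun setT Y ->
  (forall A B, measurable A -> measurable B ->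
     P (X @^-1` A `&` Y @^-1` B) = (P (X @^-1` A) * P (Y @^-1` B))%E) ->
  measurable_fun setT f -> measurable_fun setT g ->
  (forall x, `|f x| <= M) -> (forall y, `|g y| <= M) ->
  \int[P]_w (f (X w) * g (Y w)) = \int[P]_w f (X w) * \int[P]_w g (Y w).
Proof.
move=> mX mY XY mf mg fM gM.
have M0 : 0 <= M := le_trans (normr_ge0 _) (fM point).
have mfX : measurable_fun setT (f \o X) by exact: measurableT_comp.
have mgY : measurable_fun setT (g \o Y) by exact: measurableT_comp.
have ifX := bounded_integrable P mfX (fun w => fM _).
have igY := bounded_integrable P mgY (fun w => gM _).
have ic : P.-integrable setT (EFin \o cst M) by exact: finite_measure_integrable_cst.
have H := @indep_eexpM _ _ _ P _ _ _ _ X Y (fun x => f x + M) (fun y => g y + M) mX mY XY.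
have f0 x : 0 <= f x + M by have := fM x; rewrite ler_norml => /andP[? ?]; lra.
have g0 x : 0 <= g x + M by have := gM x; rewrite ler_norml => /andP[? ?]; lra.
have fM2 x : `|f x + M| <= M + M by rewrite (le_trans (ler_normD _ _))// lerD// ger0_norm.
have gM2 x : `|g x + M| <= M + M by rewrite (le_trans (ler_normD _ _))// lerD// ger0_norm.
have {}H := H (measurable_funD mf (measurable_cst _)) (measurable_funD mg (measurable_cst _)) f0 g0.
have mf2 : measurable_fun setT (fun w => f (X w) + M) by exact: measurable_funD.
have mg2 : measurable_fun setT (fun w => g (Y w) + M) by exact: measurable_funD.
rewrite (@eexp_EFin _ _ _ _ _ ((M + M) * (M + M))) in H; last 2 first.
- exact: measurable_funM.
- by move=> w; rewrite normrM ler_pM.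
rewrite (eexp_EFin _ mf2 (fun w => fM2 _)) (eexp_EFin _ mg2 (fun w => gM2 _)) in H.
rewrite -EFinM in H; move: H; case.
rewrite RintegralD// RintegralD// (Rintegral_cst_probability P).
have -> : (fun w => (f (X w) + M) * (g (Y w) + M)) =
    (fun w => f (X w) * g (Y w) + (M * (f (X w) + g (Y w)) + M * M)).
  by apply/funext => w; ring.
have ifg : P.-integrable setT (EFin \o (fun w => f (X w) * g (Y w))).
  apply: (@bounded_integrable _ _ _ P _ (M * M)); first exact: measurable_funM.
  by move=> w; rewrite normrM ler_pM.
have iD : P.-integrable setT (EFin \o (fun w => f (X w) + g (Y w)))
  by exact: (integrableD measurableT ifX igY).
have iMM : P.-integrable setT (EFin \o cst (M * M)) by exact: finite_measure_integrable_cst.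
have iMD : P.-integrable setT (EFin \o (fun w => M * (f (X w) + g (Y w)))).
  exact: (integrableZl _ M iD).
rewrite RintegralD//; last exact: (integrableD measurableT iMD iMM).
rewrite RintegralD// RintegralZl// RintegralD// (Rintegral_cst_probability P (M * M)).
lra.
Qed.

Lemma uncorrelated_sqr_sum (B : nat -> T -> R) (M : R) n :
  (forall i, measurable_fun setT (B i)) -> (forall i w, `|B i w| <= M) ->
  (forall i j, i != j -> \int[P]_w (B i w * B j w) = 0) ->
  \int[P]_w ((\sum_(i < n) B i w) ^+ 2) <= n%:R * M ^+ 2.
Proof.
move=> mB BM B0.
have iBB i j : P.-integrable setT (EFin \o (fun w => B i w * B j w)).
  apply: (@bounded_integrable _ _ _ P _ (M * M)); first exact: measurable_funM.
  by move=> w; rewrite normrM ler_pM.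
have -> : (fun w => (\sum_(i < n) B i w) ^+ 2) =
    (fun w => \sum_(i < n) \sum_(j < n) (B i w * B j w)).
  apply/funext => w; rewrite expr2 mulr_suml; apply: eq_bigr => i _.
  by rewrite mulr_sumr.
rewrite Rintegral_sum; last first.
  move=> i; rewrite (_ : _ \o _ = (fun w => \sum_(j < n) (B i w * B j w)%:E)%E).
    by apply: integrable_sum => // j _; exact: iBB.
  by apply/funext => w /=; rewrite sumEFin.
rewrite -[n in n%:R]card_ord mulr_natl -sumr_const; apply: ler_sum => i _.
rewrite Rintegral_sum; last by move=> j; exact: iBB.
rewrite (bigD1 i)//= big1 ?addr0; last first.
  by move=> j ji; rewrite B0// eq_sym.
rewrite -(Rintegral_cst_probability P (M ^+ 2)); apply: le_Rintegral => //.
  exact: finite_measure_integrable_cst.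
move=> w _; rewrite -expr2 -real_normK ?num_real// /cst.
by rewrite ler_sqr ?nnegrE// (le_trans _ (BM i w)).
Qed.

(** Values outside [-K, K] are sent to 0, not clipped to the endpoints. *)
Definition truncate (K x : R) : R := x * \1_(`[- K, K]%classic) x.

Lemma measurable_truncate K : measurable_fun setT (truncate K).
Proof. by apply: measurable_funM => //; exact: measurable_indic. Qed.

Lemma truncateE K x : truncate K x = if `|x| <= K then x else 0.
Proof.
rewrite /truncate indicE /= ler_norml.
case: ifPn => h; first by rewrite mem_set ?mulr1//= in_itv.
by rewrite memNset ?mulr0//= in_itv /=; exact/negP.
Qed.

Lemma truncate_bound K x : 0 <= K -> `|truncate K x| <= K.
Proof. by move=> K0; rewrite truncateE; case: ifPn => //; rewrite normr0. Qed.

Lemma truncate_error_bound K x : `|x - truncate K x| <= `|x|.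
Proof. by rewrite truncateE; case: ifPn => _; rewrite ?subrr ?normr0 ?subr0. Qed.

(** Dominated convergence: the error is at most |Z|, and vanishes at an outcome as soon as n >=
    |Z|. *)
Lemma truncate_error_cvg (Z : T -> R) : P.-integrable setT (EFin \o Z) ->
  eexp P (fun w => `|Z w - truncate n%:R (Z w)|) @[n --> \oo] --> 0%E.
Proof.
move=> iZ; have mZ : measurable_fun setT Z by apply/measurable_EFinP; exact: measurable_int iZ.
rewrite -[X in _ --> X](_ : (\int[P]_w cst 0 w)%E = 0%E); last by rewrite integral_cst// mul0e.
apply: (@dominated_cvg _ _ _ P setT _ _ _ (EFin \o ((@Num.norm R R) \o Z))) => //.
- move=> n; apply/measurable_EFinP; apply: measurableT_comp => //.
  by apply: measurable_funB => //; exact: measurableT_comp (measurable_truncate _) mZ.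
- move=> w _; apply/fine_cvgP; split; first exact: nearW.
  apply: cvg_near_cst; near=> n.
  rewrite /= truncateE ifT ?subrr ?normr0//.
  by near: n; exact: nbhs_infty_ger.
- exact: integrable_norm.
- by move=> n w _; rewrite /= lee_fin normr_id truncate_error_bound.
Unshelve. all: by end_near. Qed.

(** Only a first moment is available, so a variance bound is used on the truncated variables, and
    the tails are controlled in mean. The conclusion is convergence in mean, the form in which
    [cvgp0M] consumes it. *)
Lemma weak_law_large_numbers (Z : nat -> T -> R) (Z0 : T -> R) (e : R) :
  (forall i, measurable_fun setT (Z i)) ->
  P.-integrable setT (EFin \o Z0) ->
  (forall i A, measurable A -> P (Z i @^-1` A) = P (Z0 @^-1` A)) ->
  (forall i j A B, i != j -> measurable A -> measurable B ->
     P (Z i @^-1` A `&` Z j @^-1` B) = (P (Z i @^-1` A) * P (Z j @^-1` B))%E) ->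
  0 < e ->
  \forall n \near \oo,
    (eexp P (fun w => `|n%:R^-1 * (\sum_(i < n) Z i w) - \int[P]_w Z0 w|)%R <= e%:E)%E.
Proof.
move=> mZ iZ law ind e0; set c := \int[P]_w Z0 w.
have mZ0 : measurable_fun setT Z0 by apply/measurable_EFinP; exact: measurable_int iZ.
have e4 : 0 < e / 4 by rewrite divr_gt0.
have [K tauK] : exists K : nat,
    (eexp P (fun w => `|Z0 w - truncate K%:R (Z0 w)|)%R <= (e / 4)%:E)%E.
  have /fine_cvgP[H1 /cvgrPdist_le /(_ _ e4) H2] := truncate_error_cvg iZ.
  have [n [H3 H4]] := filter_ex (filterI H1 H2).
  by exists n; rewrite -[leLHS]fineK// lee_fin;
    move: H4; rewrite sub0r normrN; apply/le_trans/ler_norm.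
set tK := truncate K%:R in tauK.
have mtK : measurable_fun setT tK by exact: measurable_truncate.
have tKb x : `|tK x| <= K%:R by exact: truncate_bound.
pose cK := \int[P]_w tK (Z0 w).
pose M : R := K%:R + K%:R.
have itK : P.-integrable setT (EFin \o (tK \o Z0)).
  apply: (@bounded_integrable _ _ _ P _ K%:R) => [|w]; last exact: tKb.
  exact: measurableT_comp.
have cKb : `|cK| <= K%:R.
  rewrite /cK -(Rintegral_cst_probability P K%:R).
  apply: le_trans (le_normr_Rintegral _ itK) _ => //.
  apply: le_Rintegral => //; first exact: integrable_norm.
    exact: finite_measure_integrable_cst.
  by move=> x _; exact: tKb.
have ccK : `|cK - c| <= e / 4.
  rewrite /cK /c -RintegralB//.
  have iB : P.-integrable setT (EFin \o (fun w => tK (Z0 w) - Z0 w))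
    by exact: (integrableB measurableT itK iZ).
  apply: le_trans (le_normr_Rintegral _ iB) _ => //.
  rewrite -lee_fin /Rintegral fineK; last first.
    by apply: integrable_fin_num => //; exact: integrable_norm iB.
  by apply: le_trans tauK; under eq_integral do rewrite distrC.
pose B i w := tK (Z i w) - cK.
have mB i : measurable_fun setT (B i).
  by apply: measurable_funB => //; exact: measurableT_comp.
have BM i w : `|B i w| <= M by rewrite (le_trans (ler_normB _ _))// lerD.
have lawK i : \int[P]_w tK (Z i w) = cK.
  exact: (Rintegral_same_law (mZ i) mZ0 (law i) mtK).
have B0 i j : i != j -> \int[P]_w (B i w * B j w) = 0.
  move=> ij.
  rewrite (@indep_RintegralM _ R _ R (Z i) (Z j) (fun x => tK x - cK)
    (fun x => tK x - cK) M)//.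
  - have -> : \int[P]_w (tK (Z i w) - cK) = 0; last by rewrite mul0r.
    rewrite RintegralB//; last exact: finite_measure_integrable_cst.
      by rewrite (Rintegral_cst_probability P) lawK subrr.
    apply: (@bounded_integrable _ _ _ P _ K%:R) => [|w]; last exact: tKb.
    exact: measurableT_comp.
  - by move=> C D mC mD; exact: ind.
  - exact: measurable_funB.
  - exact: measurable_funB.
  - by move=> x; rewrite (le_trans (ler_normB _ _))// lerD.
  - by move=> x; rewrite (le_trans (ler_normB _ _))// lerD.
(* For n >= N the mean of [S] below, at most (e/4)^-1 M^2 / n, is at most e/4. *)
pose N : R := M ^+ 2 / (e / 4) / (e / 4).
near=> n.
have n0 : (0 < n)%N by near: n; exact: nbhs_infty_gt.
have nR : 0 < n%:R :> R by rewrite ltr0n.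
have nN : N <= n%:R by near: n; exact: nbhs_infty_ger.
(* The deviation is at most D + |y| + |cK - c|, where y is the centred truncated average. The bound
   |y| <= y^2 / (e/4) + e/4 = S + e/4 brings in second moments; each of the four contributions has
   mean at most e/4. *)
pose D w := n%:R^-1 * \sum_(i < n) `|Z i w - tK (Z i w)|.
pose S w := (e / 4)^-1 * (n%:R^-1 * \sum_(i < n) B i w) ^+ 2.
have mS0 : measurable_fun setT (fun w => \sum_(i < n) B i w) by exact: measurable_sum.
have mD0 i : measurable_fun setT (fun w => `|Z i w - tK (Z i w)|).
  apply: measurableT_comp => //; apply: measurable_funB => //.
  exact: measurableT_comp.
have mD : measurable_fun setT D.
  by apply: measurable_funM => //; exact: measurable_sum.
have mS : measurable_fun setT S.
  by apply: measurable_funM => //; apply: measurable_funX; exact: measurable_funM.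
have D0 w : 0 <= D w by rewrite mulr_ge0 ?invr_ge0 ?(ltW nR)// sumr_ge0.
have S0 w : 0 <= S w by rewrite mulr_ge0 ?sqr_ge0// invr_ge0 ltW.
apply: (@le_trans _ _ (eexp P (fun w => D w + (S w + (e / 4 + e / 4))))).
  apply: eexp_le => //.
  - apply: measurableT_comp => //; apply: measurable_funB => //.
    by apply: measurable_funM => //; exact: measurable_sum.
  - by apply: measurable_funD => //; exact: measurable_funD.
  move=> w.
  have -> : n%:R^-1 * (\sum_(i < n) Z i w) - c =
      n%:R^-1 * (\sum_(i < n) (Z i w - tK (Z i w))) +
      (n%:R^-1 * (\sum_(i < n) B i w) + (cK - c)).
    rewrite !sumrB sumr_const card_ord -[cK *+ n]mulr_natl.
    by field; rewrite gt_eqF.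
  apply: le_trans (ler_normD _ _) _; apply: lerD.
    rewrite normrM ger0_norm ?invr_ge0 ?(ltW nR)// ler_wpM2l ?invr_ge0 ?(ltW nR)//.
    exact: ler_norm_sum.
  apply: le_trans (ler_normD _ _) _; rewrite addrA lerD//.
  rewrite /S; set y := n%:R^-1 * _.
  have : 0 <= (`|y| - e / 4) ^+ 2 by exact: sqr_ge0.
  rewrite sqrrB real_normK ?num_real// => H.
  rewrite -(ler_pM2l e4) mulrDr mulrA divff ?gt_eqF// mul1r.
  have : 0 <= `|y| * (e / 4) by rewrite mulr_ge0// ltW.
  rewrite -[X in _ <= _ + X]expr2 [e / 4 * _]mulrC; move: H; rewrite mulr2n; lra.
rewrite eexpD//; last first.
- by move=> w; rewrite addr_ge0// addr_ge0// ltW.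
- exact: measurable_funD.
rewrite eexpD//; last by move=> w; rewrite addr_ge0// ltW.
rewrite [X in (_ + (_ + X))%E](eexp_cst P (e / 4 + e / 4)).
have -> : e%:E = ((e / 4)%:E + ((e / 4)%:E + (e / 4 + e / 4)%:E))%E.
  by rewrite -!EFinD; congr EFin; lra.
apply: leeD; last apply: leeD => //.
- rewrite /D eexpZ ?invr_ge0 ?(ltW nR)//; last 2 first.
  + exact: measurable_sum.
  + by move=> w; exact: sumr_ge0.
  rewrite eexp_sum//.
  have E i : eexp P (fun w => `|Z i w - tK (Z i w)|) = eexp P (fun w => `|Z0 w - tK (Z0 w)|).
    apply: (@ge0_integral_same_law _ _ _ P _ R (Z i) Z0 (fun x => `|x - tK x|%:E)) => //.
      exact: law.
    apply/measurable_EFinP; apply: measurableT_comp => //; exact: measurable_funB.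
  under eq_bigr do rewrite E.
  have tau_fin : eexp P (fun w => `|Z0 w - tK (Z0 w)|) \is a fin_num.
    by rewrite ge0_fin_numE ?eexp_ge0// (le_lt_trans tauK)// ltry.
  move: tauK; rewrite -(fineK tau_fin) lee_fin => tauK.
  rewrite sumEFin sumr_const card_ord -EFinM lee_fin -[X in _ * X <= _]mulr_natl mulrA.
  by rewrite mulVf ?mul1r// gt_eqF.
- have yM w : `|n%:R^-1 * \sum_(i < n) B i w| <= M.
    rewrite normrM ger0_norm ?invr_ge0 ?(ltW nR)// ler_pdivrMl//.
    rewrite mulr_natl -[n in leRHS]card_ord -sumr_const.
    by apply: le_trans (ler_norm_sum _ _ _) _; apply: ler_sum.
  have sqM w : (n%:R^-1 * \sum_(i < n) B i w) ^+ 2 <= M ^+ 2.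
    rewrite -real_normK ?num_real// ler_sqr ?nnegrE//.
    exact: le_trans (yM w).
  rewrite (@eexp_EFin _ _ _ _ _ ((e / 4)^-1 * M ^+ 2))//; last first.
    by move=> w; rewrite ger0_norm// ler_wpM2l ?invr_ge0 ?(ltW e4).
  rewrite lee_fin /S.
  have -> : (fun w => (e / 4)^-1 * (n%:R^-1 * \sum_(i < n) B i w) ^+ 2) =
     (fun w => (e / 4)^-1 * n%:R^-1 ^+ 2 * (\sum_(i < n) B i w) ^+ 2).
    by apply/funext => w; rewrite exprMn mulrA.
  have a0 : 0 <= (e / 4)^-1 * n%:R^-1 ^+ 2 by rewrite mulr_ge0 ?sqr_ge0// invr_ge0 ltW.
  rewrite RintegralZl//; last first.
    apply: (@bounded_integrable _ _ _ P _ ((n%:R * M) ^+ 2)); first exact: measurable_funX.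
    move=> w; rewrite normrX ler_sqr ?nnegrE ?mulr_ge0//.
      move: (yM w); rewrite normrM ger0_norm ?invr_ge0 ?(ltW nR)//.
      by rewrite ler_pdivrMl.
    exact: le_trans (yM w).
  apply: le_trans (ler_wpM2l a0 (uncorrelated_sqr_sum n mB BM B0)) _.
  rewrite -mulrA (_ : n%:R^-1 ^+ 2 * _ = M ^+ 2 / n%:R); last by field; rewrite gt_eqF.
  rewrite mulrA ler_pdivrMr//.
  by move: nN; rewrite /N ler_pdivrMr// mulrC [leRHS]mulrC.
Unshelve. all: by end_near. Qed.

End WeakLaw.

(** * Taylor expansion of the spatial sign projector *)

Section SignExpansion.
Variable R : realType.
Implicit Types p : nat.

(** Evaluates [ix] when one factor is trivial: this is the column index of a Kronecker product of a
    column vector with the identity, as in [Bmat]. *)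
Lemma ix_mul1n p (l : 'I_p) :
  ix (cast_ord (esym (mul1n p)) l : 'I_(1 * p)) = (0, l).
Proof.
rewrite /ix (enum_val_nth (0, l)) enumT.
transitivity (nth (0, l) (Finite.enum ('I_1 * 'I_p)%type) l); first by [].
rewrite unlock /= /prod_enum enum_ordSl enum_ord0 allpairs1l.
by rewrite (nth_map l) ?size_enum_ord ?nth_ord_enum.
Qed.

Lemma ix_muln1 p (l : 'I_p) :
  ix (cast_ord (esym (muln1 p)) l : 'I_(p * 1)) = (l, 0).
Proof.
rewrite /ix (enum_val_nth (l, 0)) enumT.
transitivity (nth (l, 0) (Finite.enum ('I_p * 'I_1)%type) l); first by [].
rewrite unlock /= /prod_enum (enum_ordSl 0) enum_ord0 allpairs1r.
by rewrite (nth_map l) ?size_enum_ord ?nth_ord_enum.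
Qed.

Definition sqnorm p (v : 'cV[R]_p) : R := \sum_i v i 0 ^+ 2.

Lemma sqnorm_ge0 p (v : 'cV[R]_p) : 0 <= sqnorm v.
Proof. by apply: sumr_ge0 => i _; exact: sqr_ge0. Qed.

Lemma enorm_sqr p (v : 'cV[R]_p) : enorm v ^+ 2 = sqnorm v.
Proof. by rewrite sqr_sqrtr// sqnorm_ge0. Qed.

Lemma enorm_ge0 p (v : 'cV[R]_p) : 0 <= enorm v.
Proof. exact: sqrtr_ge0. Qed.

Lemma ler_coord_enorm p (v : 'cV[R]_p) i : `|v i 0| <= enorm v.
Proof.
rewrite -sqrtr_sqr ler_sqrt ?sqnorm_ge0// /sqnorm (bigD1 i)//= lerDl.
by apply: sumr_ge0 => j _; exact: sqr_ge0.
Qed.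

Lemma enorm_eq0 p (v : 'cV[R]_p) : (enorm v == 0) = (v == 0).
Proof.
apply/eqP/eqP => [v0|->].
  apply/matrixP => i j; rewrite (ord1 j) mxE; apply/eqP.
  by rewrite -normr_le0 -v0 ler_coord_enorm.
by rewrite /enorm big1 ?sqrtr0// => i _; rewrite mxE expr0n.
Qed.

Lemma enorm_gt0 p (v : 'cV[R]_p) : v != 0 -> 0 < enorm v.
Proof. by rewrite -enorm_eq0 => v0; rewrite lt_neqAle eq_sym v0 enorm_ge0. Qed.

Lemma ssignE p (v : 'cV[R]_p) : ssign v = (enorm v)^-1 *: v.
Proof. by rewrite /ssign; case: eqP => // ->; rewrite scaler0. Qed.

(** Holds at [v = 0] as well, since division by 0 gives 0 in agreement with s(0) = 0; no case
    distinction on the observations is needed for this formula. *)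
Lemma sign_outerE p (v : 'cV[R]_p) i j :
  (ssign v *m (ssign v)^T) i j = v i 0 * v j 0 / sqnorm v.
Proof.
rewrite mxE big_ord1 !mxE ssignE !mxE mulrACA -invfM -expr2 enorm_sqr.
by rewrite mulrC.
Qed.

Lemma ler_normM2 (a b A B : R) : `|a| <= A -> `|b| <= B -> `|a * b| <= A * B.
Proof. by move=> aA bB; rewrite normrM ler_pM. Qed.

(** The expansion after scaling by n = |v|: a, b = v_i/n, v_j/n; y, z = h_i/n, h_j/n; s = <v,h>/n^2,
    r = |h|/n, k = |v-h|^2/n^2. For r >= 1/2 every term is bounded separately by a multiple of r.
    For r < 1/2 the numerator of the error is at most (1 + 4 + 4 + 3) r^2 and k >= (1 - r)^2 >= 1/4,
    whence the constant 48 = 12 * 4. *)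
Lemma sign_outer_taylor_scalar (a b y z s r k : R) :
  `|a| <= 1 -> `|b| <= 1 -> `|y| <= r -> `|z| <= r -> `|s| <= r ->
  k = 1 - 2 * s + r ^+ 2 -> `|(a - y) * (b - z)| <= k ->
  `|(a - y) * (b - z) / k - a * b - (2 * a * b * s - b * y - a * z)|
    <= 48 * (r * Num.sqrt r).
Proof.
move=> a1 b1 yr zr sr kE uk.
have r0 : 0 <= r := le_trans (normr_ge0 _) yr.
have q0 := sqrtr_ge0 r; have q2 := sqr_sqrtr r0.
set q := Num.sqrt r in q0 q2 *.
have ab : `|a * b| <= 1 by have := ler_normM2 a1 b1; rewrite mulr1.
have abs_ : `|a * b * s| <= r by have := ler_normM2 ab sr; rewrite mul1r.
have by_ : `|b * y| <= r by have := ler_normM2 b1 yr; rewrite mul1r.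
have az : `|a * z| <= r by have := ler_normM2 a1 zr; rewrite mul1r.
have [rbig|rsmall] := leP 2^-1 r.
- have uk1 : `|(a - y) * (b - z) / k| <= 1.
    have [k0|k0] := eqVneq k 0; first by rewrite k0 invr0 mulr0 normr0.
    have k1 : 0 < k by rewrite lt_neqAle eq_sym k0 (le_trans _ uk).
    by rewrite normrM normfV (gtr0_norm k1) ler_pdivrMr// mul1r.
  have qh : 2^-1 <= q by rewrite -(@ler_pXn2r _ 2)// ?nnegrE// q2; lra.
  have rq : r <= 2 * (r * q) by nra.
  move: uk1 ab abs_ by_ az; rewrite !ler_norml
    => /andP[? ?] /andP[? ?] /andP[? ?] /andP[? ?] /andP[? ?].
  by apply/andP; split; lra.
- have kq : 4^-1 <= k by move: sr; rewrite ler_norml kE => /andP[? ?]; nra.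
  have k0 : 0 < k by lra.
  (* Over the common denominator k = 1 - 2s + r^2 the terms of order 0 and 1 cancel. *)
  have -> : (a - y) * (b - z) / k - a * b - (2 * a * b * s - b * y - a * z) =
     (y * z + 4 * (a * b * s) * s - 2 * s * (b * y + a * z)
       - r ^+ 2 * (a * b + 2 * (a * b * s) - (b * y + a * z))) / k.
    have kn0 : k != 0 by rewrite gt_eqF.
    apply: (mulIf kn0); rewrite [RHS]divfK//.
    transitivity ((a - y) * (b - z) - k * (a * b + 2 * a * b * s - b * y - a * z)).
      by field.
    by rewrite kE; ring.
  rewrite normrM normfV (gtr0_norm k0) ler_pdivrMr//.
  have H1 : `|y * z| <= r ^+ 2 by rewrite expr2 ler_normM2.
  have H2 : `|a * b * s * s| <= r ^+ 2 by rewrite expr2 ler_normM2.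
  have v2 : `|b * y + a * z| <= 2 * r.
    by rewrite (le_trans (ler_normD _ _))// mulr2n mulrDl !mul1r lerD.
  have H3 : `|s * (b * y + a * z)| <= r * (2 * r) by exact: ler_normM2.
  have H4 : `|r ^+ 2 * (a * b + 2 * (a * b * s) - (b * y + a * z))| <= r ^+ 2 * 3.
    apply: ler_normM2; first by rewrite ger0_norm// sqr_ge0.
    move: ab abs_ v2; rewrite !ler_norml => /andP[? ?] /andP[? ?] /andP[? ?].
    by apply/andP; split; lra.
  have rq2 : r ^+ 2 <= r * q.
    rewrite expr2 ler_wpM2l// -q2 expr2 ler_piMl//.
    by rewrite -(@ler_pXn2r _ 2)// ?nnegrE// q2 expr1n; lra.
  have rq3 : 12 * r ^+ 2 <= 48 * (r * q) * k.
    have : 0 <= r * q by rewrite mulr_ge0.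
    nra.
  apply: le_trans rq3.
  move: H1 H2 H3 H4; rewrite !ler_norml => /andP[? ?] /andP[? ?] /andP[? ?] /andP[? ?].
  by apply/andP; split; lra.
Qed.

Definition dotp p (v w : 'cV[R]_p) : R := \sum_l v l 0 * w l 0.

(** Cauchy-Schwarz from 2|ab| <= c a^2 + b^2 / c, summed over the coordinates with c = |w|/|v|, the
    weight that makes both sums equal. *)
Lemma dotp_bound p (v w : 'cV[R]_p) : `|dotp v w| <= enorm v * enorm w.
Proof.
have H (a b : R) (c : R) : 0 < c -> 2 * `|a * b| <= c * a ^+ 2 + c^-1 * b ^+ 2.
  move=> c0; rewrite normrM -[a ^+ 2]real_normK ?num_real// -[b ^+ 2]real_normK ?num_real//.
  rewrite -(ler_pM2l c0) mulrDr [c * (c^-1 * _)]mulrA divff ?gt_eqF// mul1r.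
  have := sqr_ge0 (c * `|a| - `|b|); rewrite sqrrB => h; nra.
have [->|v0] := eqVneq v 0.
  rewrite /dotp big1 ?normr0 ?mulr_ge0 ?enorm_ge0// => i _.
  by rewrite mxE mul0r.
have [->|w0] := eqVneq w 0.
  rewrite /dotp big1 ?normr0 ?mulr_ge0 ?enorm_ge0// => i _.
  by rewrite mxE mulr0.
have nv := enorm_gt0 v0; have nw := enorm_gt0 w0.
have c0 : 0 < enorm w / enorm v by rewrite divr_gt0.
have : 2 * `|dotp v w| <= enorm w / enorm v * sqnorm v + (enorm w / enorm v)^-1 * sqnorm w.
  apply: (@le_trans _ _ (\sum_l 2 * `|v l 0 * w l 0|)).
    by rewrite -mulr_sumr ler_wpM2l// ler_norm_sum.
  by rewrite !mulr_sumr -big_split; apply: ler_sum => l _; exact: H.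
rewrite -!enorm_sqr invf_div.
have -> : enorm w / enorm v * enorm v ^+ 2 + enorm v / enorm w * enorm w ^+ 2 =
    2 * (enorm v * enorm w) by field; rewrite !gt_eqF.
by rewrite ler_pM2l.
Qed.

(* Entry (i, j) of minus the differential of [v |-> s(v) s(v)^T] at [v], applied to
   the l-th basis vector. *)
Definition sign_outer_diff p (v : 'cV[R]_p) (i j l : 'I_p) : R :=
  2 * (v i 0 * v j 0 * v l 0 / enorm v ^+ 4)
  - v j 0 / enorm v ^+ 2 * (i == l)%:R - (j == l)%:R * (v i 0 / enorm v ^+ 2).

Lemma sum_sign_outer_diff p (v h : 'cV[R]_p) (i j : 'I_p) :
  \sum_l sign_outer_diff v i j l * h l 0 =
  2 * (v i 0 * v j 0 * dotp v h / enorm v ^+ 4)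
  - v j 0 / enorm v ^+ 2 * h i 0 - v i 0 / enorm v ^+ 2 * h j 0.
Proof.
rewrite /sign_outer_diff; under eq_bigr do rewrite !mulrBl.
rewrite !sumrB; congr (_ - _ - _).
- rewrite /dotp mulr_sumr mulr_suml mulr_sumr; apply: eq_bigr => l _; ring.
- rewrite (bigD1 i)//= eqxx mulr1 big1 ?addr0// => l /negbTE li.
  by rewrite eq_sym li mulr0 mul0r.
- rewrite (bigD1 j)//= eqxx mul1r big1 ?addr0// => l /negbTE li.
  by rewrite eq_sym li mul0r mul0r.
Qed.

Lemma sqnormB p (v h : 'cV[R]_p) :
  sqnorm (v - h) = sqnorm v - 2 * dotp v h + sqnorm h.
Proof.
rewrite /sqnorm /dotp mulr_sumr -sumrB -big_split; apply: eq_bigr => l _ /=.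
by rewrite !mxE; ring.
Qed.

(** The projector is homogeneous of degree 0, so dividing [v] and [h] by |v| reduces to the scalar
    estimate. The case [h = v] is included, the quotient there being 0. *)
Lemma sign_outer_taylor p (v h : 'cV[R]_p) (i j : 'I_p) : v != 0 ->
  `|(v - h) i 0 * (v - h) j 0 / sqnorm (v - h) - v i 0 * v j 0 / sqnorm v
     - \sum_l sign_outer_diff v i j l * h l 0|
  <= 48 * (enorm h * Num.sqrt (enorm h)) * (enorm v * Num.sqrt (enorm v))^-1.
Proof.
move=> v0; have n0 := enorm_gt0 v0; have nn := lt0r_neq0 n0.
set n := enorm v in n0 nn *.
have div1 (w : 'cV[R]_p) l : `|w l 0 / n| <= enorm w / n.
  by rewrite normrM normfV (gtr0_norm n0) ler_pM2r ?invr_gt0// ler_coord_enorm.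
have divv l : `|v l 0 / n| <= 1 by have := div1 v l; rewrite divff.
have sb : `|dotp v h / n ^+ 2| <= enorm h / n.
  rewrite normrM normfV [`|n ^+ 2|]ger0_norm ?sqr_ge0// ler_pdivrMr ?exprn_gt0//.
  by rewrite (_ : _ * n ^+ 2 = n * enorm h) ?dotp_bound//; field.
have kE : sqnorm (v - h) / n ^+ 2 = 1 - 2 * (dotp v h / n ^+ 2) + (enorm h / n) ^+ 2.
  rewrite sqnormB -[sqnorm v]enorm_sqr -[sqnorm h]enorm_sqr -/n.
  by field.
have ub : `|(v i 0 / n - h i 0 / n) * (v j 0 / n - h j 0 / n)| <= sqnorm (v - h) / n ^+ 2.
  have -> : (v i 0 / n - h i 0 / n) * (v j 0 / n - h j 0 / n) =
    (v - h) i 0 * (v - h) j 0 / n ^+ 2 by rewrite !mxE; field.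
  rewrite normrM normfV [`|n ^+ 2|]ger0_norm ?sqr_ge0//.
  rewrite ler_pM2r ?invr_gt0 ?exprn_gt0// -enorm_sqr expr2.
  by rewrite ler_normM2// ler_coord_enorm.
have := sign_outer_taylor_scalar (divv i) (divv j) (div1 h i) (div1 h j) sb kE ub.
rewrite sqrtrM ?enorm_ge0// sqrtrV ?(ltW n0)//.
have -> : 48 * (enorm h / n * (Num.sqrt (enorm h) / Num.sqrt n)) =
    48 * (enorm h * Num.sqrt (enorm h)) * (n * Num.sqrt n)^-1.
  by rewrite invfM; ring.
apply: le_trans; rewrite le_eqVlt; apply/orP; left; apply/eqP; congr (`|_|).
rewrite sum_sign_outer_diff -[sqnorm v]enorm_sqr -/n.
have -> : (v i 0 / n - h i 0 / n) * (v j 0 / n - h j 0 / n) / (sqnorm (v - h) / n ^+ 2) =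
    (v - h) i 0 * (v - h) j 0 / sqnorm (v - h).
  have [->|k0] := eqVneq (sqnorm (v - h)) 0; first by rewrite mul0r !invr0 !mulr0.
  by move: (sqnorm _) k0 => k k0; rewrite !mxE; field; rewrite k0 nn.
congr (_ - _ - _); first by field.
by field.
Qed.

Lemma sign_outer_diff_bound p (v : 'cV[R]_p) (i j l : 'I_p) :
  `|sign_outer_diff v i j l| <= 4 * (enorm v)^-1.
Proof.
have [v0|v0] := eqVneq v 0.
  rewrite /sign_outer_diff v0 !mxE !mul0r !mulr0 !subrr normr0.
  by rewrite mulr_ge0// invr_ge0 enorm_ge0.
have n0 := enorm_gt0 v0; have nn := lt0r_neq0 n0.
set n := enorm v in n0 nn *; rewrite /sign_outer_diff -/n.
have div1 m : `|v m 0 / n| <= 1.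
  by rewrite normrM normfV (gtr0_norm n0) ler_pdivrMr// mul1r ler_coord_enorm.
have H1 : `|v i 0 / n * (v j 0 / n) * (v l 0 / n)| <= 1.
  have := ler_normM2 (ler_normM2 (div1 i) (div1 j)) (div1 l).
  by rewrite !mulr1.
have H2 : `|v j 0 / n * (i == l)%:R| <= 1.
  have := @ler_normM2 _ (i == l)%:R 1 1 (div1 j).
  by rewrite mulr1; apply; case: eqP; rewrite ?normr1 ?normr0.
have H3 : `|v i 0 / n * (j == l)%:R| <= 1.
  have := @ler_normM2 _ (j == l)%:R 1 1 (div1 i).
  by rewrite mulr1; apply; case: eqP; rewrite ?normr1 ?normr0.
have -> : 2 * (v i 0 * v j 0 * v l 0 / n ^+ 4) - v j 0 / n ^+ 2 * (i == l)%:R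
    - (j == l)%:R * (v i 0 / n ^+ 2) =
  (2 * (v i 0 / n * (v j 0 / n) * (v l 0 / n)) - v j 0 / n * (i == l)%:R
    - v i 0 / n * (j == l)%:R) * n^-1 by field.
rewrite normrM normfV (gtr0_norm n0) ler_wpM2r ?invr_ge0 ?(ltW n0)//.
move: H1 H2 H3; rewrite !ler_norml => /andP[? ?] /andP[? ?] /andP[? ?].
by apply/andP; split; lra.
Qed.

Lemma inv_pow32E p (v : 'cV[R]_p) : v != 0 ->
  inv_pow32 v = ((enorm v * Num.sqrt (enorm v))^-1)%:E.
Proof.
move=> v0; rewrite /inv_pow32 (negbTE v0) powRN; congr ((_^-1)%:E).
have -> : 3 / 2 = 1 + 2^-1 :> R by field.
rewrite powRD ?enorm_eq0 ?v0 ?implybT//.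
by rewrite powRr1 ?enorm_ge0// powR12_sqrt ?enorm_ge0.
Qed.

Lemma inv_pow32_ge0 p (v : 'cV[R]_p) : (0 <= inv_pow32 v)%E.
Proof. by rewrite /inv_pow32; case: ifP => // _; rewrite lee_fin powR_ge0. Qed.

(** With x = |v|^(-1/2) this reads x^2 <= 1 + x^3. Through it (II) yields the first inverse moment,
    which makes the expectations in [Bmat] finite. *)
Lemma invr_enorm_le p (v : 'cV[R]_p) :
  (((enorm v)^-1)%:E <= 1%:E + inv_pow32 v)%E.
Proof.
have [v0|v0] := eqVneq v 0; first by rewrite /inv_pow32 v0 eqxx /= addey// leey.
rewrite inv_pow32E// -EFinD lee_fin.
have n0 := enorm_gt0 v0; set n := enorm v in n0 *.
have s0 : 0 < Num.sqrt n by rewrite sqrtr_gt0.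
rewrite invfM; set x := (Num.sqrt n)^-1; have x0 : 0 < x by rewrite invr_gt0.
have -> : n^-1 = x ^+ 2 by rewrite /x exprVn sqr_sqrtr// ltW.
have [x1|x1] := leP x 1.
  have : x ^+ 2 <= 1 by rewrite expr_le1// ltW.
  have : 0 <= x ^+ 2 * x by rewrite mulr_ge0 ?sqr_ge0// ltW.
  by lra.
have : x ^+ 2 <= x ^+ 2 * x by rewrite ler_peMr ?sqr_ge0// ltW.
by lra.
Qed.

End SignExpansion.

(** * Slutsky's lemma *)

Section Slutsky.
Variable R : realType.
Implicit Types k m : nat.

(* The largest [c]-Lipschitz minorant of [g]; it increases to [g] as [c -> +oo]. *)
Definition infconv k (g : 'cV[R]_k -> R) (c : R) (v : 'cV[R]_k) : R :=
  inf [set g z + c * norm1 (v - z) | z in setT].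

Section InfConvolution.
Variables (k : nat) (g : 'cV[R]_k -> R) (M c : R).
Hypotheses (gM : forall v, `|g v| <= M) (c0 : 0 <= c).

Let values v := [set g z + c * norm1 (v - z) | z in setT].

Let values_lb v : lbound (values v) (- M).
Proof.
move=> _ [z _ <-]; have := gM z; rewrite ler_norml => /andP[H _].
by rewrite (le_trans H)// lerDl mulr_ge0// norm1_ge0.
Qed.

Lemma infconv_le v z : infconv g c v <= g z + c * norm1 (v - z).
Proof. by apply: ge_inf; [exists (- M); exact: values_lb|exists z]. Qed.

Lemma infconv_ge v x : (forall z, x <= g z + c * norm1 (v - z)) -> x <= infconv g c v.
Proof.
move=> H; apply: lb_le_inf; first by exists (g v + c * norm1 (v - v)); exists v.
by move=> _ [z _ <-].
Qed.

Lemma infconv_le_id v : infconv g c v <= g v.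
Proof. by have := infconv_le v v; rewrite subrr norm10 mulr0 addr0. Qed.

Lemma infconv_bound v : `|infconv g c v| <= M.
Proof.
rewrite ler_norml; apply/andP; split.
  by apply: infconv_ge => z; apply: (values_lb (v := v)); exists z.
by rewrite (le_trans (infconv_le_id v))// (le_trans (ler_norm _)).
Qed.

Lemma infconv_lipschitz v w : `|infconv g c v - infconv g c w| <= c * norm1 (v - w).
Proof.
have H a b : infconv g c a - c * norm1 (a - b) <= infconv g c b.
  apply: infconv_ge => z; rewrite lerBlDr; apply: le_trans (infconv_le a z) _.
  rewrite -addrA lerD2l -mulrDr ler_wpM2l//.
  apply: le_trans (norm1D _ _); rewrite (_ : b - z + (a - b) = a - z)//.
  by rewrite addrC addrA subrK.
rewrite ler_norml; have := H v w; have := H w v.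
by rewrite -[norm1 (w - v)]norm1N opprB => ? ?; apply/andP; split; lra.
Qed.

End InfConvolution.

(** A competitor [z] at distance at least [r] pays a penalty n r >= 2M, which exceeds any possible
    gain; a closer one gains less than [e] by continuity at [v]. *)
Lemma infconv_cvg k (g : 'cV[R]_k -> R) (M : R) v : continuous g ->
  (forall v, `|g v| <= M) -> infconv g n%:R v @[n --> \oo] --> g v.
Proof.
move=> cg gM; apply/cvgrPdist_le => e e0.
have /cvgrPdist_lt/(_ e e0) := cg v; rewrite near_nbhs.
move=> /nbhs_ballP[r /= r0 rg].
near=> n.
have le1 := infconv_le_id gM (ler0n R n) v.
rewrite ger0_norm ?subr_ge0// lerBlDr -lerBlDl; apply: infconv_ge => z.
have [zr|zr] := ltP (norm1 (v - z)) r.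
- have /rg : ball v r z.
    split=> // i j; rewrite (ord1 j) /ball /= /ball_; apply: le_lt_trans zr.
    rewrite /norm1 (bigD1 i)//= !mxE lerDl; exact: sumr_ge0.
  rewrite /= => H; have := mulr_ge0 (ler0n R n) (norm1_ge0 (v - z)).
  by move: H; rewrite ltr_norml => /andP[? ?] ?; lra.
- have Hn : 2 * M / r <= n%:R by near: n; exact: nbhs_infty_ger.
  have H2 : 2 * M <= n%:R * norm1 (v - z).
    by move: Hn; rewrite ler_pdivrMr// => Hn; rewrite (le_trans Hn)// ler_wpM2l.
  have := gM v; have := gM z; rewrite !ler_norml => /andP[? ?] /andP[? ?]; lra.
Unshelve. all: by end_near. Qed.

(** * Convergence to 0 in probability, and Slutsky's lemma *)

Context {d : measure_display} {T : measurableType d}.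
Variable P : probability T R.

(* [E cap1 U_n -> 0] is convergence of [U_n] to [0] in probability. *)
Definition cap1 (x : R) : R := Num.min 1 `|x|.

Lemma cap1_ge0 x : 0 <= cap1 x.
Proof. by rewrite /cap1 le_min ler01 normr_ge0. Qed.

Lemma cap1_le_norm x : cap1 x <= `|x|.
Proof. by rewrite /cap1 ge_min lexx orbT. Qed.

Lemma cap1D x y : cap1 (x + y) <= cap1 x + cap1 y.
Proof.
have := ler_normD x y; have := normr_ge0 x; have := normr_ge0 y.
by rewrite /cap1; case: (leP 1 `|x + y|) => ?; case: (leP 1 `|x|) => ?;
  case: (leP 1 `|y|) => ? *; lra.
Qed.

Lemma cap1_sum (I : Type) (s : seq I) (F : I -> R) :
  cap1 (\sum_(i <- s) F i) <= \sum_(i <- s) cap1 (F i).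
Proof.
elim: s => [|i s IH]; first by rewrite !big_nil /cap1 normr0 ge_min lexx orbT.
by rewrite !big_cons (le_trans (cap1D _ _))// lerD2l.
Qed.

Lemma le_cap1 x y : `|x| <= `|y| -> cap1 x <= cap1 y.
Proof. by move=> xy; rewrite /cap1 le_min2. Qed.

(* If [v <= c] then [u v <= c u]; otherwise [1 <= v / c]. *)
Lemma cap1M u v c : 0 < c -> cap1 (u * v) <= c * `|u| + c^-1 * `|v|.
Proof.
move=> c0; have [vc|cv] := leP `|v| c.
  rewrite (le_trans (cap1_le_norm _))// normrM mulrC.
  by rewrite (le_trans (ler_wpM2r (normr_ge0 u) vc))// lerDl mulr_ge0// invr_ge0 ltW.
rewrite (le_trans (_ : cap1 _ <= 1))//; first by rewrite /cap1 ge_min lexx.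
have : 1 <= c^-1 * `|v| by rewrite ler_pdivlMl// mulr1 ltW.
have : 0 <= c * `|u| by rewrite mulr_ge0// ltW.
lra.
Qed.

Lemma measurable_cap1 (U : T -> R) : measurable_fun setT U ->
  measurable_fun setT (fun w => cap1 (U w)).
Proof.
by move=> mU; apply: measurable_minr => //; exact: measurableT_comp.
Qed.

Definition cvgp0 (U : nat -> T -> R) : Prop :=
  forall e : R, 0 < e -> \forall n \near \oo, (eexp P (fun w => cap1 (U n w)) <= e%:E)%E.

Lemma near_eexp_cap1_sum (I : finType) (U : I -> nat -> T -> R) (e : R) :
  (forall i n, measurable_fun setT (U i n)) -> (forall i, cvgp0 (U i)) -> 0 < e ->
  \forall n \near \oo, (eexp P (fun w => \sum_i cap1 (U i n w))%R <= e%:E)%E.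
Proof.
move=> mU cU e0.
have e1 : 0 < e / #|I|.+1%:R by rewrite divr_gt0.
have H : \forall n \near \oo, forall i,
    (eexp P (fun w => cap1 (U i n w))%R <= (e / #|I|.+1%:R)%:E)%E.
  by apply: filter_forall => i; exact: cU.
apply: filterS H => n H; rewrite eexp_sum; last 2 first.
- by move=> i; exact: measurable_cap1.
- by move=> i w; exact: cap1_ge0.
apply: (@le_trans _ _ (\sum_(i : I) (e / #|I|.+1%:R)%:E)%E).
  by apply: lee_sum => i _; exact: H.
rewrite sumEFin lee_fin sumr_const -[leLHS]mulr_natl mulrA ler_pdivrMr//.
by rewrite mulrC ler_pM2l// ler_nat.
Qed.

Lemma cvgp0_sum (I : finType) (U : I -> nat -> T -> R) :
  (forall i n, measurable_fun setT (U i n)) -> (forall i, cvgp0 (U i)) ->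
  cvgp0 (fun n w => \sum_i U i n w).
Proof.
move=> mU cU e e0; apply: filterS (near_eexp_cap1_sum mU cU e0) => n.
apply: le_trans; apply: eexp_le => [|||w]; last exact: cap1_sum.
- by apply: measurable_cap1; exact: measurable_sum.
- by apply: measurable_sum => i; exact: measurable_cap1.
- by move=> w; exact: cap1_ge0.
Qed.

Lemma cvgp0D (U V : nat -> T -> R) :
  (forall n, measurable_fun setT (U n)) -> (forall n, measurable_fun setT (V n)) ->
  cvgp0 U -> cvgp0 V -> cvgp0 (fun n w => U n w + V n w).
Proof.
move=> mU mV cU cV e e0.
pose F (b : bool) := if b then U else V.
have mF b n : measurable_fun setT (F b n) by case: b.
have cF b : cvgp0 (F b) by case: b.
apply: filterS (cvgp0_sum mF cF e0) => n.
by under eq_fun do rewrite big_bool.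
Qed.

(** A factor vanishing in mean times a factor bounded in mean vanishes in probability. Nothing links
    the two factors, so [cap1M] separates them before integration. *)
Lemma cvgp0M (U V : nat -> T -> R) (C : R) :
  (forall n, measurable_fun setT (U n)) -> (forall n, measurable_fun setT (V n)) ->
  (forall e : R, 0 < e -> \forall n \near \oo, (eexp P (fun w => `|U n w|%R) <= e%:E)%E) ->
  (\forall n \near \oo, (eexp P (fun w => `|V n w|%R) <= C%:E)%E) ->
  cvgp0 (fun n w => U n w * V n w).
Proof.
move=> mU mV cU bV e e0.
have C0 : 0 < `|C| + 1 by rewrite ltr_wpDl.
(* Chosen so that C / c <= e/2; the other factor is then taken so small that c E|U| <= e/2. *)
pose c := 2 * (`|C| + 1) / e.
have c0 : 0 < c by rewrite divr_gt0// mulr_gt0.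
have e1 : 0 < e / 2 / c by rewrite divr_gt0// divr_gt0.
have cU' := cU _ e1.
near=> n.
have mUn : measurable_fun setT (fun w => `|U n w|) by exact: measurableT_comp.
have mVn : measurable_fun setT (fun w => `|V n w|) by exact: measurableT_comp.
apply: (@le_trans _ _ (eexp P (fun w => c * `|U n w| + c^-1 * `|V n w|))).
  apply: eexp_le => [|||w]; last exact: cap1M.
  - by apply: measurable_cap1; exact: measurable_funM.
  - by apply: measurable_funD; apply: measurable_funM.
  - by move=> w; exact: cap1_ge0.
rewrite eexpD; try by [apply: measurable_funM|move=> w; rewrite mulr_ge0// ?invr_ge0 ltW].
rewrite !eexpZ ?invr_ge0 ?(ltW c0)//.
apply: (@le_trans _ _ (c%:E * (e / 2 / c)%:E + (c^-1)%:E * C%:E)%E).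
  apply: leeD; apply: lee_wpmul2l; rewrite ?lee_fin ?invr_ge0 ?(ltW c0)//.
  - by near: n; apply: filterS cU' => n.
  - by near: n; apply: filterS bV => n.
rewrite -!EFinM -EFinD lee_fin mulrC divfK ?gt_eqF//.
have : c^-1 * C <= e / 2.
  rewrite /c invf_div mulrAC ler_pdivrMr ?mulr_gt0//.
  rewrite (_ : e / 2 * (2 * (`|C| + 1)) = e * (`|C| + 1)); last by field.
  by rewrite ler_pM2l// (le_trans (ler_norm C))// lerDl.
lra.
Unshelve. all: by end_near. Qed.

Lemma cap1_norm1 k (v : 'cV[R]_k) : cap1 (norm1 v) <= \sum_i cap1 (v i 0).
Proof.
apply: le_trans (cap1_sum _ _) _; apply: ler_sum => i _.
by apply: le_cap1; rewrite normr_id.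
Qed.

(** One-sided because a Lipschitz minorant gives g(Y) >= gj(Y) >= gj(W) - C U. The three thirds of
    [e] pay for replacing [g] by [gj] in the limit, for the convergence along [W], and for C E U. *)
Lemma slutsky_lower m k (Y W : nat -> T -> 'cV[R]_m) (L : 'M[R]_(m, k)) :
  (forall n i, measurable_fun setT (fun w => Y n w i 0)) ->
  (forall n i, measurable_fun setT (fun w => W n w i 0)) ->
  (forall g : 'cV[R]_m -> R, continuous g -> (exists M : R, forall v, `|g v| <= M) ->
     \int[P]_w g (W n w) @[n --> \oo] --> gauss_exp (fun z => g (L *m z))) ->
  (forall i, cvgp0 (fun n w => (Y n w - W n w) i 0)) ->
  forall (g : 'cV[R]_m -> R) (M e : R), continuous g -> (forall v, `|g v| <= M) -> 0 < e ->
    \forall n \near \oo, gauss_exp (fun z => g (L *m z)) - e <= \int[P]_w g (Y n w).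
Proof.
move=> mY mW cW YW g M e cg gM e0.
have M0 : 0 <= M := le_trans (normr_ge0 _) (gM 0).
have e3 : 0 < e / 3 by rewrite divr_gt0.
pose gj (j : nat) := infconv g j%:R.
have gjL j v w : `|gj j v - gj j w| <= j%:R * norm1 (v - w).
  exact: infconv_lipschitz gM (ler0n R j) v w.
have gjM j v : `|gj j v| <= M by exact: infconv_bound gM (ler0n R j) v.
have gjc j : continuous (gj j) := lipschitz_norm1_continuous (gjL j).
have : gauss_exp (fun z => gj j (L *m z)) @[j --> \oo] --> gauss_exp (fun z => g (L *m z)).
  apply: (@cvg_gauss_exp _ _ _ _ M) => [j|j v|v].
  - exact/seqcont_mulmx/continuous_seqcont.
  - exact: gjM.
  - exact: infconv_cvg gM.
move=> /cvgrPdist_le/(_ _ e3) H; have [j Hj] := filter_ex H.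
have cWj := cW _ (gjc j) (ex_intro _ M (gjM j)).
move/cvgrPdist_le : cWj => /(_ _ e3) cWj.
(* The increment of [gj j] is at most j |Y - W|_1 and at most 2M, hence at most C min(1, |Y - W|_1);
   the added 1 keeps C positive. *)
pose C : R := j%:R + 2 * M + 1.
have C0 : 0 < C by rewrite ltr_wpDl// addr_ge0// mulr_ge0.
have e4 : 0 < e / 3 / C by rewrite divr_gt0.
pose U n w := \sum_i cap1 ((Y n w - W n w) i 0).
have mYW n i : measurable_fun setT (fun w => (Y n w - W n w) i 0).
  by under eq_fun do rewrite !mxE; exact: measurable_funB.
have mU n : measurable_fun setT (U n).
  by apply: measurable_sum => i; exact: measurable_cap1.
have U0 n w : 0 <= U n w by apply: sumr_ge0 => i _; exact: cap1_ge0.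
have UH : \forall n \near \oo, (eexp P (U n) <= (e / 3 / C)%:E)%E.
  exact: (near_eexp_cap1_sum (U := fun i n w => (Y n w - W n w) i 0)).
near=> n.
have Hn1 : `|gauss_exp (fun z => gj j (L *m z)) - \int[P]_w gj j (W n w)| <= e / 3.
  by near: n.
have Hn2 : (eexp P (U n) <= (e / 3 / C)%:E)%E by near: n.
have mg : measurable_fun setT (fun w => g (Y n w)).
  by apply: measurable_seqcont_comp => //; exact: continuous_seqcont.
have mgW : measurable_fun setT (fun w => gj j (W n w)).
  by apply: measurable_seqcont_comp => //; exact/continuous_seqcont/gjc.
have ig := bounded_integrable P mg (fun w => gM _).
have igW := bounded_integrable P mgW (fun w => gjM j _).
have UM w : `|U n w| <= m%:R.
  rewrite ger0_norm// -[m in m%:R]card_ord -sumr_const; apply: ler_sum => i _.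
  by rewrite /cap1 ge_min lexx.
have iU := bounded_integrable P (mU n) UM.
have iCU : P.-integrable setT (EFin \o (fun w => C * U n w)) by exact: (integrableZl _ C iU).
have ineq w : gj j (W n w) - C * U n w <= g (Y n w).
  have h1 := infconv_le_id gM (ler0n R j) (Y n w).
  suff : gj j (W n w) - gj j (Y n w) <= C * U n w by rewrite /gj in h1 *; lra.
  have h2 : gj j (W n w) - gj j (Y n w) <= j%:R * norm1 (Y n w - W n w).
    by rewrite (le_trans (ler_norm _))// distrC.
  have h3 : gj j (W n w) - gj j (Y n w) <= 2 * M.
    by have := gjM j (W n w); have := gjM j (Y n w);
      rewrite !ler_norml => /andP[? ?] /andP[? ?]; lra.
  apply: (@le_trans _ _ (C * cap1 (norm1 (Y n w - W n w)))); last first.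
    by rewrite ler_wpM2l ?(ltW C0)// cap1_norm1.
  have N0 := norm1_ge0 (Y n w - W n w).
  rewrite /cap1 ger0_norm//; have [N1|N1] := leP 1 (norm1 (Y n w - W n w)).
    by rewrite mulr1 (le_trans h3)// /C; have := ler0n R j; lra.
  rewrite (le_trans h2)// ler_wpM2r// /C; lra.
have : \int[P]_w (gj j (W n w) - C * U n w) <= \int[P]_w g (Y n w).
  apply: le_Rintegral => //; exact: (integrableB measurableT igW iCU).
rewrite RintegralB// RintegralZl//.
have : \int[P]_w U n w <= e / 3 / C.
  by rewrite -lee_fin -(eexp_EFin P (mU n) UM).
rewrite ler_pdivlMr// mulrC => h1 h2.
move: Hj Hn1; rewrite !ler_norml => /andP[? ?] /andP[? ?]; lra.
Unshelve. all: by end_near. Qed.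

Lemma slutsky m k (Y W : nat -> T -> 'cV[R]_m) (L : 'M[R]_(m, k)) :
  (forall n i, measurable_fun setT (fun w => Y n w i 0)) ->
  (forall n i, measurable_fun setT (fun w => W n w i 0)) ->
  (forall g : 'cV[R]_m -> R, continuous g -> (exists M : R, forall v, `|g v| <= M) ->
     \int[P]_w g (W n w) @[n --> \oo] --> gauss_exp (fun z => g (L *m z))) ->
  (forall i, cvgp0 (fun n w => (Y n w - W n w) i 0)) ->
  forall g : 'cV[R]_m -> R, continuous g -> (exists M : R, forall v, `|g v| <= M) ->
    \int[P]_w g (Y n w) @[n --> \oo] --> gauss_exp (fun z => g (L *m z)).
Proof.
move=> mY mW cW YW g cg [M gM]; apply/cvgrPdist_le => e e0.
have lo := slutsky_lower mY mW cW YW cg gM e0.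
(* The upper bound is the lower bound for [- g]. *)
have cg' : continuous (fun v : 'cV[R]_m => - g v).
  move=> v; apply/(@cvgrPdist_lt _ _ _ _ (nbhs_filter v)) => x x0.
  have /cvgrPdist_lt/(_ x x0) := cg v; apply: filterS => z.
  by rewrite -opprD normrN.
have gM' v : `|- g v| <= M by rewrite normrN.
have hi := slutsky_lower mY mW cW YW cg' gM' e0.
have sgL : seqcont (fun z => g (L *m z)) by exact/seqcont_mulmx/continuous_seqcont.
have gN : gauss_exp (fun z => - g (L *m z)) = - gauss_exp (fun z => g (L *m z)).
  rewrite -[RHS]addr0 -mulN1r -(@gauss_exp_affine _ _ _ M (-1) 0 sgL)//.
  by congr gauss_exp; apply/funext => z; rewrite mulN1r addr0.
near=> n.
have h1 : gauss_exp (fun z => g (L *m z)) - e <= \int[P]_w g (Y n w) by near: n.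
have h2 : gauss_exp (fun z => - g (L *m z)) - e <= \int[P]_w (- g (Y n w)) by near: n.
have mg : measurable_fun setT (fun w => g (Y n w)).
  by apply: measurable_seqcont_comp => //; exact: continuous_seqcont.
have ig := bounded_integrable P mg (fun w => gM _).
have E : \int[P]_w (- g (Y n w)) = - \int[P]_w g (Y n w).
  by rewrite -mulN1r -RintegralZl//; apply: eq_Rintegral => w _; rewrite mulN1r.
by rewrite ler_norml; apply/andP; split; move: h1 h2; rewrite E gN; lra.
Unshelve. all: by end_near. Qed.

End Slutsky.

(** * Linearization of the spatial sign covariance matrix *)

Section RandomVectors.
Variable R : realType.
Implicit Types p : nat.

Definition vgen p : set (set 'cV[R]_p) :=
  [set A | exists (k : 'I_p) (B : set R), measurable B /\
                 A = (fun v : 'cV[R]_p => v k 0) @^-1` B].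

(** Column vectors with the sigma-algebra [vmeas] as a measurable type, so that the image measure
    lemmas apply to random vectors. *)
Definition vspace p := g_sigma_algebraType (@vgen p).

Lemma measurable_coord p (i : 'I_p) :
  measurable_fun setT (fun v : vspace p => (v : 'cV[R]_p) i 0).
Proof.
by move=> _ B mB; rewrite setTI; apply: sub_sigma_algebra; exists i, B.
Qed.

Lemma rvec_measurable d (T : measurableType d) p (V : T -> 'cV[R]_p) :
  rvec V -> measurable_fun setT (V : T -> vspace p).
Proof.
move=> mV; apply: (@measurability d _ T (vspace p) setT V (@vgen p) erefl).
move=> _ [_ [k [B [mB ->]] <-]].
rewrite setTI -[X in measurable X]setTI; exact: mV.
Qed.

Context {d : measure_display} {U : measurableType d}.

Lemma measurable_invr (f : U -> R) : measurable_fun setT f -> (forall u, 0 <= f u) ->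
  measurable_fun setT (fun u => (f u)^-1).
Proof.
move=> mf f0; rewrite (_ : (fun u => (f u)^-1) = (fun u => f u `^ (-1))); last first.
  by apply/funext => u; rewrite powR_inv1.
have H := measurableT_comp (measurable_powR (-1)) mf.
exact: H.
Qed.

Variables (p : nat) (V : U -> 'cV[R]_p).
Hypothesis mV : forall i, measurable_fun setT (fun u => V u i 0).

Lemma measurable_sqnorm : measurable_fun setT (fun u => sqnorm (V u)).
Proof. by apply: measurable_sum => i; exact: measurable_funX. Qed.

Lemma measurable_enorm : measurable_fun setT (fun u => enorm (V u)).
Proof.
apply: (measurableT_comp (f := @Num.sqrt R)); last exact: measurable_sqnorm.
exact: continuous_measurable_fun (@sqrt_continuous R).
Qed.

Lemma measurable_invr_enorm k : measurable_fun setT (fun u => (enorm (V u) ^+ k)^-1).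
Proof.
apply: measurable_invr; first exact: measurable_funX measurable_enorm.
by move=> u; rewrite exprn_ge0// enorm_ge0.
Qed.

Lemma measurable_sign_outer i j :
  measurable_fun setT (fun u => V u i 0 * V u j 0 / sqnorm (V u)).
Proof.
apply: measurable_funM; first exact: measurable_funM.
by apply: measurable_invr; [exact: measurable_sqnorm|move=> u; exact: sqnorm_ge0].
Qed.

Lemma measurable_sign_outer_diff i j l :
  measurable_fun setT (fun u => sign_outer_diff (V u) i j l).
Proof.
apply: measurable_funB; first apply: measurable_funB.
- apply: measurable_funM => //; apply: measurable_funM; last exact: measurable_invr_enorm.
  by apply: measurable_funM => //; exact: measurable_funM.
- apply: measurable_funM => //; apply: measurable_funM => //.
  exact: measurable_invr_enorm.
- apply: measurable_funM => //; apply: measurable_funM => //.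
  exact: measurable_invr_enorm.
Qed.

Lemma measurable_inv_pow32 : measurable_fun setT (fun u => inv_pow32 (V u)).
Proof.
rewrite /inv_pow32; under eq_fun do rewrite -enorm_eq0.
apply: measurable_fun_ifT => //.
  by apply: measurable_fun_eqr => //; exact: measurable_enorm.
apply/measurable_EFinP.
have H := measurableT_comp (measurable_powR (- (3 / 2))) measurable_enorm.
exact: H.
Qed.

End RandomVectors.

(** * Sample averages and the matrix B *)

Section Sample.
Context {R : realType} {d : measure_display} {T : measurableType d}.
Variables (P : probability T R) (p : nat).
Variables (X : T -> 'cV[R]_p) (Xs : nat -> T -> 'cV[R]_p) (t : 'cV[R]_p).
Hypotheses (mX : rvec X) (mXs : forall i, rvec (Xs i)).
Hypotheses (indXs : mutually_indep P Xs) (lawXs : forall i, same_law P (Xs i) X).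
Hypothesis inv32 : (\int[P]_w inv_pow32 (X w - t) < +oo)%E.

Lemma measurable_shift d' (U : measurableType d') (V : U -> 'cV[R]_p) (s : 'cV[R]_p) i :
  measurable_fun setT (fun u => V u i 0) -> measurable_fun setT (fun u => (V u - s) i 0).
Proof. by move=> mV; under eq_fun do rewrite !mxE; exact: measurable_funB. Qed.

Lemma sample_preimage (phi : 'cV[R]_p -> R) (A : set R) :
  measurable_fun setT (phi : vspace R p -> R) -> measurable A -> vmeas (phi @^-1` A).
Proof.
move=> mphi mA.
have : measurable ((phi : vspace R p -> R) @^-1` A).
  by rewrite -[X in measurable X]setTI; exact: mphi.
by [].
Qed.

Lemma sample_lln (phi : 'cV[R]_p -> R) (e : R) :
  measurable_fun setT (phi : vspace R p -> R) ->
  P.-integrable setT (EFin \o (fun w => phi (X w))) -> 0 < e ->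
  \forall n \near \oo,
    (eexp P (fun w => `|n%:R^-1 * (\sum_(i < n) phi (Xs i w)) - \int[P]_w phi (X w)|)%R <= e%:E)%E.
Proof.
move=> mphi iphi e0.
apply: (@weak_law_large_numbers _ _ _ P (fun i w => phi (Xs i w)) (fun w => phi (X w))) => //.
- by move=> i; exact: measurableT_comp mphi (rvec_measurable (mXs i)).
- by move=> i A mA; exact: (lawXs i (sample_preimage mphi mA)).
- move=> i j A B ij mA mB.
  pose C m := if m == i then phi @^-1` A else phi @^-1` B.
  have := @indXs [:: i; j] C; rewrite /= inE ij => /(_ isT).
  have mC m : m \in [:: i; j] -> vmeas (C m).
    by move=> _; rewrite /C; case: ifP => _; exact: sample_preimage.
  move=> /(_ mC); rewrite !big_cons big_nil mule1 /C eqxx eq_sym (negbTE ij) => <-.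
  congr (P _); apply/seteqP; split => w /=.
    move=> [wA wB] m /=; rewrite !inE => /orP[/eqP ->|/eqP ->]; first by rewrite eqxx.
    by rewrite eq_sym (negbTE ij).
  move=> H; split; first by have /= := H i; rewrite !inE eqxx => /(_ isT).
  by have /= := H j; rewrite !inE eqxx orbT eq_sym (negbTE ij) => /(_ isT).
Qed.

Lemma integrable_invr_enorm (f : T -> R) (c : R) : measurable_fun setT f ->
  0 <= c -> (forall w, `|f w| <= c * (enorm (X w - t))^-1) ->
  P.-integrable setT (EFin \o f).
Proof.
move=> mf c0 fc; apply/integrableP; split; first exact/measurable_EFinP.
have mI : measurable_fun setT (fun w => inv_pow32 (X w - t)).
  by apply: measurable_inv_pow32 => i; exact: measurable_shift.
have m1 : measurable_fun setT (fun w => 1%:E + inv_pow32 (X w - t))%E.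
  exact: emeasurable_funD.
have I0 w : (0 <= 1%:E + inv_pow32 (X w - t))%E.
  by rewrite adde_ge0// ?lee_fin// inv_pow32_ge0.
apply: (@le_lt_trans _ _ (\int[P]_w (c%:E * (1%:E + inv_pow32 (X w - t))))%E).
  apply: ge0_le_integral => //.
  - by apply: measurableT_comp => //; exact/measurable_EFinP.
  - exact: measurable_funeM.
  - move=> w _; apply: (@le_trans _ _ (c%:E * ((enorm (X w - t))^-1)%:E)%E).
      by rewrite -EFinM lee_fin.
    by apply: lee_wpmul2l; rewrite ?lee_fin//; exact: invr_enorm_le.
rewrite ge0_integralZl ?lee_fin//.
rewrite ge0_integralD//; last by move=> w _; exact: inv_pow32_ge0.
rewrite -[X in (_ * (X + _))%E]/(eexp P (cst 1)) eexp_cst.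
by rewrite lte_mul_pinfty// ?lee_fin// lte_add_pinfty// ltry.
Qed.

Lemma integrable_sign_outer_diff i j l :
  P.-integrable setT (EFin \o (fun w => sign_outer_diff (X w - t) i j l)).
Proof.
apply: (@integrable_invr_enorm _ 4) => //; last by move=> w; exact: sign_outer_diff_bound.
by apply: measurable_sign_outer_diff => k; exact: measurable_shift.
Qed.

(** Since [vec] stacks columns, the row index is the first component of [ix k] for the column [j]
    and the second for the row [i]. Thus the entry of E(u) (x) I_p is E(u_j) [i = l] and that of I_p
    (x) E(u) is [j = l] E(u_i), the last two terms of [sign_outer_diff]. *)
Lemma BmatE k l : Bmat P X t k l =
  \int[P]_w sign_outer_diff (X w - t) (ix k).2 (ix k).1 l.
Proof.
set i := (ix k).2; set j := (ix k).1.
have mC m : measurable_fun setT (fun w => (X w - t) m 0) by exact: measurable_shift.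
set x := fun w => X w - t.
have div1 w m : `|x w m 0 / enorm (x w)| <= 1.
  have [->|n0] := eqVneq (enorm (x w)) 0; first by rewrite invr0 mulr0 normr0.
  have n1 : 0 < enorm (x w) by rewrite lt_neqAle eq_sym n0 enorm_ge0.
  by rewrite normrM normfV (gtr0_norm n1) ler_pdivrMr// mul1r ler_coord_enorm.
have iu m : P.-integrable setT (EFin \o (fun w => x w m 0 / enorm (x w) ^+ 2)).
  apply: (@integrable_invr_enorm _ 1) => // [|w].
    by apply: measurable_funM => //; exact: measurable_invr_enorm.
  rewrite expr2 invfM mulrA normrM ler_pM//.
  by rewrite ger0_norm ?invr_ge0 ?enorm_ge0.
have iv : P.-integrable setT
    (EFin \o (fun w => x w i 0 * x w j 0 * x w l 0 / enorm (x w) ^+ 4)).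
  apply: (@integrable_invr_enorm _ 1) => // [|w].
    apply: measurable_funM; last exact: measurable_invr_enorm.
    by apply: measurable_funM => //; exact: measurable_funM.
  rewrite (_ : _ / _ = x w i 0 / enorm (x w) * (x w j 0 / enorm (x w)) *
    (x w l 0 / enorm (x w)) / enorm (x w)); last first.
    by rewrite !exprS expr0 mulr1 !invfM; ring.
  rewrite normrM ler_pM//; last by rewrite ger0_norm ?invr_ge0 ?enorm_ge0.
  by have := ler_normM2 (ler_normM2 (div1 w i) (div1 w j)) (div1 w l); rewrite !mulr1.
have Ev : mexp P (fun w => (enorm (x w) ^+ 4)^-1 *: (kron (x w) (x w) *m (x w)^T)) k l =
    \int[P]_w (x w i 0 * x w j 0 * x w l 0 / enorm (x w) ^+ 4).
  rewrite mxE; apply: eq_Rintegral => w _; rewrite !mxE big_ord1 !mxE.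
  by rewrite !ord1 -/i -/j; ring.
have Eu m : mexp P (fun w => (enorm (x w) ^+ 2)^-1 *: x w) m 0 =
    \int[P]_w (x w m 0 / enorm (x w) ^+ 2).
  by rewrite mxE; apply: eq_Rintegral => w _; rewrite mxE mulrC.
have subE (A B : 'M[R]_(p * p, p)) : (A - B) k l = A k l - B k l by rewrite !mxE.
have scaleE a (A : 'M[R]_(p * p, p)) : (a *: A) k l = a * A k l by rewrite mxE.
have kronE m1 n1 m2 n2 (A : 'M[R]_(m1, n1)) (B : 'M[R]_(m2, n2)) r c :
    kron A B r c = A (ix r).1 (ix c).1 * B (ix r).2 (ix c).2 by rewrite mxE.
rewrite /Bmat !subE scaleE Ev !castmxE !kronE !cast_ord_id ix_mul1n ix_muln1 /=.
rewrite !Eu -/i -/j !mxE.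
have i1 : P.-integrable setT
    (EFin \o (fun w => 2 * (x w i 0 * x w j 0 * x w l 0 / enorm (x w) ^+ 4))).
  exact: (integrableZl _ 2 iv).
have i2 : P.-integrable setT (EFin \o (fun w => x w j 0 / enorm (x w) ^+ 2 * (i == l)%:R)).
  exact: (integrableZr _ (i == l)%:R (iu j)).
have i3 : P.-integrable setT (EFin \o (fun w => (j == l)%:R * (x w i 0 / enorm (x w) ^+ 2))).
  exact: (integrableZl _ (j == l)%:R (iu i)).
rewrite RintegralB//; last exact: (integrableB measurableT i1 i2).
rewrite RintegralB//.
by rewrite (RintegralZl _ measurableT iv) (RintegralZr _ measurableT (iu j))
  (RintegralZl _ measurableT (iu i)).
Qed.

(** * Size of the two remainders *)

Variable tn : nat -> T -> 'cV[R]_p.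
Hypothesis mtn : forall n, rvec (tn n).
Hypothesis moment4 : exists (C : R) (N : nat), forall n : nat, (N <= n)%N ->
  (\int[P]_w ((enorm (tn n w - t)) ^+ 4)%:E <= (C / (n%:R ^+ 2))%:E)%E.

Let x q w := Xs q w - t.
Let h n w := tn n w - t.
Let alpha (n : nat) w : R := Num.sqrt n%:R * enorm (h n w).

Let mx q i : measurable_fun setT (fun w => x q w i 0).
Proof. by apply: measurable_shift; exact: mXs. Qed.

Let mh n i : measurable_fun setT (fun w => h n w i 0).
Proof. by apply: measurable_shift; exact: mtn. Qed.

Let mxh q n i : measurable_fun setT (fun w => (x q w - h n w) i 0).
Proof.
rewrite (_ : (fun w => _) = (fun w => x q w i 0 - h n w i 0)).
  by apply: measurable_funB; [exact: mx|exact: mh].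
by apply/funext => w; rewrite !mxE.
Qed.

Let malpha n : measurable_fun setT (alpha n).
Proof. by apply: measurable_funM => //; apply: measurable_enorm => i; exact: mh. Qed.

Let alpha_ge0 n w : 0 <= alpha n w.
Proof. by rewrite mulr_ge0 ?sqrtr_ge0 ?enorm_ge0. Qed.

Lemma alpha_moments : exists2 C : R, 0 < C &
  \forall n \near \oo, (eexp P (alpha n) <= C%:E)%E /\
    (eexp P (fun w => alpha n w ^+ 2)%R <= C%:E)%E.
Proof.
have [C [N HC]] := moment4.
exists (1 + `|C|); first by rewrite ltr_wpDr.
near=> n.
have n0 : 0 < n%:R :> R by rewrite ltr0n; near: n; exact: nbhs_infty_gt.
have Nn : (N <= n)%N by near: n; exact: nbhs_infty_ge.
have m4 : measurable_fun setT (fun w => alpha n w ^+ 4) by exact: measurable_funX.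
have a4 w : 0 <= alpha n w ^+ 4 by rewrite exprn_ge0.
have E4 : (eexp P (fun w => alpha n w ^+ 4)%R <= `|C|%:E)%E.
  have -> : (fun w => alpha n w ^+ 4) = (fun w => n%:R ^+ 2 * enorm (h n w) ^+ 4).
    apply/funext => w; rewrite /alpha exprMn.
    by rewrite -[4%N]/(2 * 2)%N exprM sqr_sqrtr ?ler0n// -exprM.
  rewrite eexpZ; last 3 first.
  - by apply: measurable_funX; apply: measurable_enorm => i; exact: mh.
  - by move=> w; rewrite exprn_ge0// enorm_ge0.
  - by rewrite sqr_ge0.
  apply: (@le_trans _ _ ((n%:R ^+ 2)%:E * (C / n%:R ^+ 2)%:E)%E).
    by apply: lee_wpmul2l; [rewrite lee_fin sqr_ge0|exact: HC].
  rewrite -EFinM lee_fin mulrC divfK ?ler_norm//.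
  by rewrite expf_neq0// gt_eqF.
have E14 : (eexp P (fun w => 1 + alpha n w ^+ 4)%R <= (1 + `|C|)%:E)%E.
  rewrite (@eexpD _ _ _ P (cst 1))//.
  by rewrite eexp_cst EFinD leeD2l.
have m14 : measurable_fun setT (fun w => 1 + alpha n w ^+ 4) by exact: measurable_funD.
split; apply: le_trans E14; apply: eexp_le => //.
(* The two squares add up to a <= a^4 + 1/2. *)
- move=> w; have := sqr_ge0 (alpha n w ^+ 2 - 2^-1); have := sqr_ge0 (alpha n w - 2^-1).
  by move: (alpha n w) => a; lra.
- exact: measurable_funX.
- by move=> w; rewrite sqr_ge0.
- move=> w; have := sqr_ge0 (alpha n w ^+ 2 - 1); have := sqr_ge0 (alpha n w).
  by move: (alpha n w) => a; lra.
Unshelve. all: by end_near. Qed.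

Let beta (n : nat) w : R :=
  Num.sqrt n%:R * (48 * (enorm (h n w) * Num.sqrt (enorm (h n w)))).

Let mbeta n : measurable_fun setT (beta n).
Proof.
have me : measurable_fun setT (fun w => enorm (h n w)).
  by apply: measurable_enorm => i; exact: mh.
have ms : measurable_fun setT (fun w => Num.sqrt (enorm (h n w))).
  apply: (measurableT_comp (f := @Num.sqrt R)); last exact: me.
  exact: continuous_measurable_fun (@sqrt_continuous R).
by apply: measurable_funM => //; apply: measurable_funM => //; exact: measurable_funM.
Qed.

Let beta_ge0 n w : 0 <= beta n w.
Proof. by rewrite !mulr_ge0 ?sqrtr_ge0 ?enorm_ge0. Qed.

(** Fractional moments are avoided: sqrt m <= dl + m / dl with m = |h| = alpha / sqrt n bounds
    [beta] by 48 dl alpha + 48 alpha^2 / (dl sqrt n), where only the first two moments of [alpha]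
    enter. *)
Lemma beta_small (e : R) : 0 < e -> \forall n \near \oo, (eexp P (beta n) <= e%:E)%E.
Proof.
move=> e0; have [C C0 HC] := alpha_moments.
(* Makes 48 dl C = e/2; the bound sqrt n >= [M] below makes the quadratic term at most e/2 in
   mean. *)
pose dl := e / 96 / C.
have dl0 : 0 < dl by rewrite !divr_gt0.
pose M := 96 * C / dl / e.
near=> n.
have nR : 0 < n%:R :> R by rewrite ltr0n; near: n; exact: nbhs_infty_gt.
have [a1 a2] : (eexp P (alpha n) <= C%:E)%E /\
    (eexp P (fun w => alpha n w ^+ 2)%R <= C%:E)%E by near: n.
have s0 : 0 < Num.sqrt n%:R :> R by rewrite sqrtr_gt0.
have sM : M <= Num.sqrt n%:R.
  have M2 : M ^+ 2 <= n%:R by near: n; exact: nbhs_infty_ger.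
  by rewrite (le_trans (ler_norm M))// -sqrtr_sqr ler_sqrt// ltW.
have ma2 : measurable_fun setT (fun w => alpha n w ^+ 2) by exact: measurable_funX.
pose c1 := 48 * dl; pose c2 := 48 / dl / Num.sqrt n%:R.
have c10 : 0 <= c1 by rewrite mulr_ge0// ltW.
have c20 : 0 <= c2 by rewrite !divr_ge0// ltW.
apply: (@le_trans _ _ (eexp P (fun w => c1 * alpha n w + c2 * alpha n w ^+ 2))).
  apply: eexp_le => //.
    by apply: measurable_funD; apply: measurable_funM.
  move=> w; rewrite /beta /c1 /c2 /alpha.
  have m0 := enorm_ge0 (h n w); set m := enorm (h n w) in m0 *.
  have q0 := sqrtr_ge0 m; have q2 := sqr_sqrtr m0; set q := Num.sqrt m in q0 q2 *.
  have qd : q <= dl + m / dl.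
    rewrite -(ler_pM2l dl0) mulrDr [dl * (m / dl)]mulrC divfK ?gt_eqF// -q2.
    have := sqr_ge0 (dl - q); rewrite sqrrB => H.
    have : 0 <= dl * q by rewrite mulr_ge0// ltW.
    by move: H; rewrite -expr2 mulr2n; lra.
  set s := Num.sqrt n%:R in s0 *.
  have -> : 48 * dl * (s * m) + 48 / dl / s * (s * m) ^+ 2 = 48 * (s * m) * (dl + m / dl).
    by field; rewrite !gt_eqF.
  rewrite (_ : s * (48 * (m * q)) = 48 * (s * m) * q); last by ring.
  by rewrite ler_wpM2l// !mulr_ge0// ltW.
rewrite eexpD; try by [exact: measurable_funM|move=> w; rewrite mulr_ge0// ?sqr_ge0].
rewrite (@eexpZ _ _ _ P c1 (alpha n) (malpha n) (alpha_ge0 n) c10).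
rewrite (@eexpZ _ _ _ P c2 _ ma2 (fun w => sqr_ge0 _) c20).
apply: (@le_trans _ _ (c1%:E * C%:E + c2%:E * C%:E)%E).
  by apply: leeD; apply: lee_wpmul2l; rewrite ?lee_fin.
rewrite -!EFinM -EFinD lee_fin.
have -> : c1 * C = e / 2 by rewrite /c1 /dl; field; rewrite gt_eqF.
suff : c2 * C <= e / 2 by lra.
rewrite /c2 mulrAC ler_pdivrMr//.
move: sM; rewrite /M ler_pdivrMr// => sM.
rewrite (_ : 48 / dl * C = 96 * C / dl / 2); last by field; rewrite gt_eqF.
by rewrite ler_pdivrMr// (le_trans sM)// mulrC mulrAC divfK.
Unshelve. all: by end_near. Qed.

Let rho i j (v u : 'cV[R]_p) : R :=
  (v - u) i 0 * (v - u) j 0 / sqnorm (v - u) - v i 0 * v j 0 / sqnorm v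
  - \sum_l sign_outer_diff v i j l * u l 0.

Let mrho i j q n : measurable_fun setT (fun w => rho i j (x q w) (h n w)).
Proof.
apply: measurable_funB; first apply: measurable_funB.
- exact: (measurable_sign_outer (mxh q n)).
- exact: (measurable_sign_outer (mx q)).
- apply: measurable_sum => l; apply: measurable_funM; last exact: mh.
  exact: (measurable_sign_outer_diff (mx q)).
Qed.

(** The nonlinear remainder: the scaled average of the Taylor errors [rho]. *)
Let remA i j (n : nat) w : R :=
  Num.sqrt n%:R * (n%:R^-1 * \sum_(q < n) rho i j (x q w) (h n w)).

Let mremA i j n : measurable_fun setT (remA i j n).
Proof.
apply: measurable_funM => //; apply: measurable_funM => //.
by apply: measurable_sum => q; exact: mrho.
Qed.

Lemma remA_pointwise i j (n : nat) w (K : R) : (0 < n)%N -> 0 < K ->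
  ((cap1 (remA i j n w))%:E <= (K * beta n w)%:E
     + (K^-1 * n%:R^-1)%:E * \sum_(q < n) inv_pow32 (x q w))%E.
Proof.
move=> n0 K0; have nR : 0 < n%:R :> R by rewrite ltr0n.
have c0 : 0 < K^-1 * n%:R^-1 by rewrite mulr_gt0 ?invr_gt0.
(* If some [X_q = t] the right-hand side is [+oo]. *)
have [/existsP[q /eqP xq]|] := boolP [exists q : 'I_n, x q w == 0].
  rewrite (_ : \sum_(q < n) _ = +oo)%E; last first.
    rewrite (bigD1 q)//= {1}/inv_pow32 xq eqxx addye// gt_eqF//.
    by rewrite (lt_le_trans (ltNyr 0))// sume_ge0// => m _; exact: inv_pow32_ge0.
  by rewrite gt0_muley ?lte_fin// addey ?leey.
rewrite negb_exists => /forallP xn0.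
pose v (q : 'I_n) := (enorm (x q w) * Num.sqrt (enorm (x q w)))^-1.
have v0 q : 0 <= v q by rewrite invr_ge0 mulr_ge0 ?enorm_ge0 ?sqrtr_ge0.
have -> : (\sum_(q < n) inv_pow32 (x q w) = (\sum_(q < n) v q)%:E)%E.
  by rewrite -sumEFin; apply: eq_bigr => q _; rewrite inv_pow32E.
rewrite -EFinM -EFinD lee_fin.
set S := \sum_(q < n) v q; have S0 : 0 <= S by exact: sumr_ge0.
apply: (@le_trans _ _ (cap1 (beta n w * (n%:R^-1 * S)))); last first.
  apply: le_trans (cap1M _ _ K0) _.
  by rewrite ger0_norm// [X in _ + _ * X]ger0_norm ?mulrA// mulr_ge0// invr_ge0 ltW.
have S1 : 0 <= n%:R^-1 * S by rewrite mulr_ge0// invr_ge0 ltW.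
apply: le_cap1; rewrite [leRHS](ger0_norm (mulr_ge0 (beta_ge0 n w) S1)).
rewrite /remA /beta normrM ger0_norm ?sqrtr_ge0// -mulrA ler_wpM2l ?sqrtr_ge0//.
rewrite normrM ger0_norm ?invr_ge0 ?(ltW nR)// mulrCA ler_wpM2l ?invr_ge0 ?(ltW nR)//.
apply: le_trans (ler_norm_sum _ _ _) _; rewrite mulr_sumr; apply: ler_sum => q _.
exact: sign_outer_taylor.
Qed.

Lemma integral_inv_pow32 q :
  (\int[P]_w inv_pow32 (x q w) = \int[P]_w inv_pow32 (X w - t))%E.
Proof.
apply: (@ge0_integral_same_law _ _ _ P _ (vspace R p) (Xs q) X
  (fun v : vspace R p => inv_pow32 ((v : 'cV[R]_p) - t))).
- exact: rvec_measurable.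
- exact: rvec_measurable.
- by move=> A mA; exact: (lawXs q).
- by apply: measurable_inv_pow32 => i; apply: measurable_shift; exact: measurable_coord.
- by move=> v; exact: inv_pow32_ge0.
Qed.

Lemma remA_cvgp0 i j : cvgp0 P (remA i j).
Proof.
move=> e e0; pose I := (\int[P]_w inv_pow32 (X w - t))%E.
have Iy : (I < +oo)%E := inv32.
have I0 : (0 <= I)%E by apply: integral_ge0 => w _; exact: inv_pow32_ge0.
have If : I \is a fin_num by rewrite ge0_fin_numE.
have f0 : 0 <= fine I by exact: fine_ge0.
(* Weight of the splitting: the averaged inverse moment contributes I / K <= e/2, and [beta_small]
   at level e/2/K contributes the other half. *)
pose K := 2 * (fine I + 1) / e.
have K0 : 0 < K by rewrite divr_gt0// mulr_gt0// ltr_wpDl.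
have eK : 0 < e / 2 / K by apply: divr_gt0 => //; exact: divr_gt0.
have bs := beta_small eK.
near=> n.
have n0 : (0 < n)%N by near: n; exact: nbhs_infty_gt.
have nR : 0 < n%:R :> R by rewrite ltr0n.
have bn : (eexp P (beta n) <= (e / 2 / K)%:E)%E by near: n.
have mi q : measurable_fun setT (fun w => inv_pow32 (x q w)).
  exact: (measurable_inv_pow32 (mx q)).
have ms : measurable_fun setT (fun w => \sum_(q < n) inv_pow32 (x q w))%E.
  exact: emeasurable_sum.
have s0 w : (0 <= \sum_(q < n) inv_pow32 (x q w))%E.
  by apply: sume_ge0 => q _; exact: inv_pow32_ge0.
have c0 : 0 <= K^-1 * n%:R^-1 by rewrite mulr_ge0// invr_ge0 ltW.
apply: (@le_trans _ _ (\int[P]_w ((K * beta n w)%:E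
     + (K^-1 * n%:R^-1)%:E * \sum_(q < n) inv_pow32 (x q w)))%E).
  apply: ge0_le_integral => //.
  - by move=> w _; rewrite lee_fin cap1_ge0.
  - by apply/measurable_EFinP; exact: measurable_cap1.
  - apply: emeasurable_funD; last exact: measurable_funeM.
    by apply/measurable_EFinP; exact: measurable_funM.
  - by move=> w _; exact: remA_pointwise.
rewrite ge0_integralD//; last 4 first.
- by move=> w _; rewrite lee_fin mulr_ge0// ltW.
- by apply/measurable_EFinP; exact: measurable_funM.
- by move=> w _; rewrite mule_ge0.
- exact: measurable_funeM.
rewrite -/(eexp P (fun w => K * beta n w)) eexpZ ?(ltW K0)//.
rewrite ge0_integralZl ?lee_fin// ge0_integral_sum//; last first.
  by move=> q w _; exact: inv_pow32_ge0.
under [X in (_ + _ * X)%E]eq_bigr do rewrite integral_inv_pow32 -/I -(fineK If).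
rewrite sumEFin sumr_const card_ord -EFinM.
apply: (@le_trans _ _ (K%:E * (e / 2 / K)%:E + (K^-1 * n%:R^-1 * (fine I *+ n))%:E)%E).
  by rewrite leeD2r// lee_wpmul2l// lee_fin ltW.
rewrite -EFinM -EFinD lee_fin mulrC divfK ?gt_eqF// -[fine I *+ n]mulr_natl.
rewrite -mulrA [n%:R^-1 * _]mulrA mulVf ?gt_eqF// mul1r.
have : K^-1 * fine I <= e / 2.
  rewrite /K invf_div mulrAC ler_pdivrMr ?mulr_gt0 ?ltr_wpDl//.
  rewrite (_ : e / 2 * (2 * (fine I + 1)) = e * (fine I + 1)); last by field.
  by rewrite ler_pM2l// lerDl.
lra.
Unshelve. all: by end_near. Qed.

(** The error made by replacing the average differential by its mean, one coordinate of sqrt n h at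
    a time. *)
Let remB i j l (n : nat) w : R :=
  (n%:R^-1 * (\sum_(q < n) sign_outer_diff (x q w) i j l)
    - \int[P]_w sign_outer_diff (X w - t) i j l)
  * (Num.sqrt n%:R * h n w l 0).

Let mremB i j l n : measurable_fun setT (remB i j l n).
Proof.
apply: measurable_funM; last by apply: measurable_funM => //; exact: mh.
apply: measurable_funB => //; apply: measurable_funM => //.
by apply: measurable_sum => q; exact: (measurable_sign_outer_diff (mx q)).
Qed.

Lemma remB_cvgp0 i j l : cvgp0 P (remB i j l).
Proof.
have [C C0 HC] := alpha_moments.
apply: (@cvgp0M _ _ _ P _ _ C).
- move=> n; apply: measurable_funB => //; apply: measurable_funM => //.
  by apply: measurable_sum => q; exact: (measurable_sign_outer_diff (mx q)).
- by move=> n; apply: measurable_funM => //; exact: mh.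
- move=> e e0.
  apply: (@sample_lln (fun v => sign_outer_diff (v - t) i j l)) => //.
    apply: measurable_sign_outer_diff => k; apply: measurable_shift.
    exact: measurable_coord.
  exact: integrable_sign_outer_diff.
- apply: filterS HC => n [H _]; apply: le_trans H; apply: eexp_le => //.
    by apply: measurableT_comp => //; apply: measurable_funM => //; exact: mh.
  move=> w; rewrite normrM ger0_norm ?sqrtr_ge0// /alpha.
  by rewrite ler_wpM2l ?sqrtr_ge0// ler_coord_enorm.
Qed.

(** * Exact decomposition of the linearization error *)

Definition sign_cov_scaled (n : nat) w : 'cV[R]_(p * p) :=
  Num.sqrt n%:R *: vec (Sn Xs n (tn n w) w - SF P X t).

Definition joint_scaled (n : nat) w : 'cV[R]_(p + p * p) :=
  Num.sqrt n%:R *: col_mx (tn n w - t) (vec (Sn Xs n t w - SF P X t)).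

Let SnE n u w i j : Sn Xs n u w i j =
  n%:R^-1 * \sum_(q < n) ((Xs q w - u) i 0 * (Xs q w - u) j 0 / sqnorm (Xs q w - u)).
Proof.
rewrite mxE summxE; congr (_ * _); apply: eq_bigr => q _.
exact: sign_outerE.
Qed.

(** An algebraic identity at every outcome: S(F,t) cancels between the two vectors, and B h is
    subtracted from the average differential applied to h. *)
Lemma linearization_error (n : nat) w k :
  (sign_cov_scaled n w - Amat P X t *m joint_scaled n w) k 0 =
  remA (ix k).2 (ix k).1 n w + \sum_l remB (ix k).2 (ix k).1 l n w.
Proof.
set i := (ix k).2; set j := (ix k).1; pose s : R := Num.sqrt n%:R.
have Bk : (Bmat P X t *m h n w) k 0 =
    \sum_l (\int[P]_w sign_outer_diff (X w - t) i j l) * h n w l 0.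
  by rewrite mxE; apply: eq_bigr => l _; rewrite BmatE.
have -> : (sign_cov_scaled n w - Amat P X t *m joint_scaled n w) k 0 =
    s * (Sn Xs n (tn n w) w i j - Sn Xs n t w i j) - s * (Bmat P X t *m h n w) k 0.
  rewrite /joint_scaled -scalemxAr /Amat mul_row_col mul1mx.
  have subE m (u v : 'cV[R]_m) a : (u - v) a 0 = u a 0 - v a 0 by rewrite !mxE.
  have addE m (u v : 'cV[R]_m) a : (u + v) a 0 = u a 0 + v a 0 by rewrite !mxE.
  have scaleE m b (u : 'cV[R]_m) a : (b *: u) a 0 = b * u a 0 by rewrite mxE.
  have vecE (M N : 'M[R]_p) : vec (M - N) k 0 = M i j - N i j by rewrite !mxE.
  rewrite /sign_cov_scaled subE !scaleE addE !vecE -/(h n w) -/s.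
  by ring.
rewrite !SnE Bk /remA /remB -/s.
have xh q : Xs q w - tn n w = x q w - h n w by rewrite /x /h opprB addrA subrK.
under eq_bigr do rewrite xh.
rewrite -/(x _ w) /rho !sumrB.
under [X in _ = _ + X]eq_bigr do rewrite mulrBl.
rewrite sumrB exchange_big /=.
have -> : \sum_l n%:R^-1 * (\sum_(q < n) sign_outer_diff (x q w) i j l) * (s * h n w l 0) =
    s * (n%:R^-1 * \sum_l \sum_(q < n) sign_outer_diff (x q w) i j l * h n w l 0).
  rewrite !mulr_sumr; apply: eq_bigr => l _.
  by rewrite -mulr_suml; ring.
have -> : \sum_l (\int[P]_w sign_outer_diff (X w - t) i j l) * (s * h n w l 0) =
    s * \sum_l (\int[P]_w sign_outer_diff (X w - t) i j l) * h n w l 0.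
  by rewrite mulr_sumr; apply: eq_bigr => l _; rewrite mulrCA.
by ring.
Qed.

Lemma linearization_error_cvgp0 k :
  cvgp0 P (fun n w => (sign_cov_scaled n w - Amat P X t *m joint_scaled n w) k 0).
Proof.
under eq_fun do under eq_fun do rewrite linearization_error.
apply: cvgp0D => [n|n||].
- exact: mremA.
- by apply: measurable_sum => l; exact: mremB.
- exact: remA_cvgp0.
- by apply: cvgp0_sum => l; [move=> n; exact: mremB|exact: remB_cvgp0].
Qed.

Let mSn n (u : T -> 'cV[R]_p) i j : rvec u ->
  measurable_fun setT (fun w => Sn Xs n (u w) w i j).
Proof.
move=> mu; under eq_fun do rewrite SnE.
apply: measurable_funM => //; apply: measurable_sum => q.
apply: measurable_sign_outer => m; under eq_fun do rewrite !mxE.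
by apply: measurable_funB; [exact: mXs|exact: mu].
Qed.

Lemma measurable_sign_cov_scaled n k :
  measurable_fun setT (fun w => sign_cov_scaled n w k 0).
Proof.
rewrite (_ : (fun w => _) = (fun w => Num.sqrt n%:R *
    (Sn Xs n (tn n w) w (ix k).2 (ix k).1 - SF P X t (ix k).2 (ix k).1))).
  by apply: measurable_funM => //; apply: measurable_funB => //; exact: mSn.
by apply/funext => w; rewrite !mxE.
Qed.

Lemma measurable_joint_scaled n k :
  measurable_fun setT (fun w => joint_scaled n w k 0).
Proof.
under eq_fun do rewrite mxE.
apply: measurable_funM => //; case: (splitP k) => l kl.
- have -> : k = lshift (p * p) l by apply/val_inj.
  under eq_fun do rewrite col_mxEu; exact: mh.
- have -> : k = rshift p l by apply/val_inj.
  under eq_fun do rewrite col_mxEd.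
  rewrite (_ : (fun w => _) = (fun w =>
      Sn Xs n t w (ix l).2 (ix l).1 - SF P X t (ix l).2 (ix l).1)).
    apply: measurable_funB => //; apply: (@mSn n (cst t)).
    by move=> i; exact: measurable_cst.
  by apply/funext => w; rewrite !mxE.
Qed.

End Sample.

(** * Continuous mapping and conclusion *)

Lemma continuous_mulmx (R : realType) m k (A : 'M[R]_(m, k)) :
  continuous (fun v : 'cV[R]_k => A *m v).
Proof.
move=> v B /nbhs_ballP[e /= e0 eB].
pose C := \sum_i \sum_j `|A i j|.
have C0 : 0 < C + 1 by rewrite ltr_wpDl//; do 2 (apply: sumr_ge0 => ? _).
suff : \forall w \near v, B (A *m w) by [].
near=> w; apply: eB; split => // i j; rewrite (ord1 j) /ball /= /ball_.
have Hw : norm1 (w - v) < e / (C + 1).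
  by near: w; apply: near_norm1; rewrite divr_gt0.
apply: (@le_lt_trans _ _ (norm1 (A *m (w - v)))).
  rewrite /norm1 (bigD1 i)//= mulmxBr [(A *m w - _) i 0]mxE [(- (A *m v)) i 0]mxE.
  by rewrite distrC lerDl; exact: sumr_ge0.
apply: le_lt_trans (norm1_mulmx _ _) _; rewrite -/C.
apply: (@le_lt_trans _ _ ((C + 1) * norm1 (w - v))).
  by rewrite ler_wpM2r ?norm1_ge0// lerDl.
by rewrite mulrC -ltr_pdivlMr.
Unshelve. all: by end_near. Qed.

Theorem theorem3 (R : realType) (d : measure_display) (T : measurableType d)
  (P : probability T R) (p : nat)
  (X : T -> 'cV[R]_p) (Xs : nat -> T -> 'cV[R]_p) (t : 'cV[R]_p)
  (tn : nat -> T -> 'cV[R]_p) (Xi : 'M[R]_(p + p * p)) :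
  (2 <= p)%N ->
  rvec X -> (forall i, rvec (Xs i)) -> (forall n, rvec (tn n)) ->
  mutually_indep P Xs -> (forall i, same_law P (Xs i) X) ->
  (* (I)  E|t_n - t|^4 = O(n^-2) *)
  (exists (C : R) (N : nat), forall n : nat, (N <= n)%N ->
     (\int[P]_w ((enorm (tn n w - t)) ^+ 4)%:E <= (C / (n%:R ^+ 2))%:E)%E) ->
  (* (II)  E|X - t|^{-3/2} < oo *)
  (\int[P]_w inv_pow32 (X w - t) < +oo)%E ->
  (* (III) *)
  Xi^T = Xi ->
  cvg_dist_normal P
    (fun n w => Num.sqrt (n%:R) *: col_mx (tn n w - t) (vec (Sn Xs n t w - SF P X t)))
    Xi ->
  cvg_dist_normal P
    (fun n w => Num.sqrt (n%:R) *: vec (Sn Xs n (tn n w) w - SF P X t))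
    (Amat P X t *m Xi *m (Amat P X t)^T).
Proof.
move=> _ mX mXs mtn indXs lawXs moment4 inv32 _ [L [LXi cvgL]].
set A := Amat P X t.
have [N NL same] := gauss_exp_square (A *m L).
exists N; split; first by rewrite NL trmx_mul -LXi !mulmxA.
move=> g cg [M gM].
rewrite -(same g M (continuous_seqcont cg) gM).
pose W n w := A *m joint_scaled P X Xs t tn n w.
have mW n i : measurable_fun setT (fun w => W n w i 0).
  under eq_fun do rewrite mxE.
  apply: measurable_sum => k; apply: measurable_funM => //.
  exact: measurable_joint_scaled.
apply: (slutsky (W := W)) => //.
- by move=> n i; exact: measurable_sign_cov_scaled.
(* Continuous mapping: (III) is tested on [f] composed with [A]. *)
- move=> f cf [K fK].
  have cfA : continuous (fun v => f (A *m v)).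
    by move=> v; apply: continuous_comp; [exact: continuous_mulmx|exact: cf].
  have := cvgL _ cfA (ex_intro _ K (fun v => fK _)).
  rewrite (_ : (fun z => f (A *m (L *m z))) = (fun z => f (A *m L *m z))) //.
  by apply/funext => z; rewrite mulmxA.
- by move=> k; exact: linearization_error_cvgp0.
- by exists M.
Qed.
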